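(* Let $F$ be an almost-bipartite graph that is not a star. There exists $m_0$ such that for all $m\ge m_0$: if $G$ is an $m$-edge spectral extremal graph for $F$, then one of the following holds: (a) $G$ is a complete bipartite graph; (b) $V(G)$ has a partition $A\sqcup C$ such that $|A|<|F|$, $G[A]$ is a non-empty graph (i.e. has at least one edge) belonging to $\mathcal{M}_F$, $C$ is an independent set, and all but at most one vertex of $C$ are adjacent to every vertex of $A$.
   Context: All graphs are finite and simple; isolated vertices are ignored (so $G$ is assumed to have no isolated vertices). $|F|$ is the number of vertices of $F$. A graph $F$ is almost-bipartite if it can be made bipartite by removing at most one edge. For such $F$, $\mathcal{A}_F$ is the family of subgraphs of $F$ induced by $V(F)\setminus I$, where $I$ ranges over all maximal independent sets of $F$; $\mathcal{M}_F$ is the family of all graphs (possibly with isolated vertices, possibly edgeless) that contain no subgraph isomorphic to a member of $\mathcal{A}_F$. $\lambda(G)$ is the spectral radius of the adjacency matrix. An $m$-edge spectral extremal graph for $F$ is an $F$-free graph with $m$ edges whose spectral radius is maximum among all $F$-free graphs with $m$ edges ($F$-free meaning no subgraph isomorphic to $F$). *)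

(* Defs.v *)
From mathcomp Require Import all_boot all_order all_algebra all_field.
Set Implicit Arguments. Unset Strict Implicit. Unset Printing Implicit Defensive.
Import Order.TTheory GRing.Theory Num.Theory.

Record graph := Graph {
  gn : nat;
  gadj : rel 'I_gn;
  gsym : symmetric gadj;
  girr : irreflexive gadj }.
Arguments gadj : clear implicits.

Definition nverts (G : graph) : nat := gn G.

Definition nedges (G : graph) : nat :=
  #|[set p : 'I_(gn G) * 'I_(gn G) | (p.1 < p.2)%N && gadj G p.1 p.2]|.

Definition no_isolated (G : graph) : Prop :=
  forall x : 'I_(gn G), exists y, gadj G x y.

Definition contains (H F : graph) : Prop :=
  exists phi : 'I_(gn F) -> 'I_(gn H),
    injective phi /\ forall x y, gadj F x y -> gadj H (phi x) (phi y).

Definition F_free (F H : graph) : Prop := ~ contains H F.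

Definition almost_bipartite (F : graph) : Prop :=
  exists (col : 'I_(gn F) -> bool) (a b : 'I_(gn F)),
    forall x y, gadj F x y -> col x = col y ->
      (x = a /\ y = b) \/ (x = b /\ y = a).

Definition is_star (F : graph) : Prop :=
  exists c : 'I_(gn F), forall x y, gadj F x y -> x = c \/ y = c.

Definition independent (G : graph) (I : {set 'I_(gn G)}) : bool :=
  [forall x in I, forall y in I, ~~ gadj G x y].

Definition max_independent (G : graph) (I : {set 'I_(gn G)}) : bool :=
  maxset (independent (G := G)) I.

(* The subgraph of G induced on A contains a subgraph isomorphic to the
   subgraph of F induced on S (all vertices of S, including isolated ones,
   must be mapped injectively into A). *)
Definition induced_contains (G : graph) (A : {set 'I_(gn G)})
    (F : graph) (S : {set 'I_(gn F)}) : Prop :=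
  exists phi : 'I_(gn F) -> 'I_(gn G),
    {in S &, injective phi} /\ {in S, forall x, phi x \in A} /\
    {in S &, forall x y, gadj F x y -> gadj G (phi x) (phi y)}.

(* G[A] belongs to M_F: it contains no member of A_F = { F[V(F) \ I] :
   I maximal independent set of F } *)
Definition in_M (F : graph) (G : graph) (A : {set 'I_(gn G)}) : Prop :=
  forall I : {set 'I_(gn F)}, max_independent I ->
    ~ induced_contains A (~: I).

Local Open Scope ring_scope.

Definition adjmx (G : graph) : 'M[algC]_(gn G) :=
  \matrix_(i, j) (gadj G i j)%:R.

Definition spectral_radius (G : graph) (r : algC) : Prop :=
  (exists2 l, eigenvalue (adjmx G) l & `|l| = r) /\
  (forall l, eigenvalue (adjmx G) l -> `|l| <= r).

Definition spectral_extremal (F : graph) (m : nat) (G : graph) : Prop :=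
  F_free F G /\ nedges G = m /\
  forall H : graph, F_free F H -> nedges H = m ->
    forall rG rH, spectral_radius G rG -> spectral_radius H rH -> rH <= rG.

Definition complete_bipartite (G : graph) : Prop :=
  exists col : 'I_(gn G) -> bool, forall x y, gadj G x y = (col x != col y).

Definition outcome_b (F G : graph) : Prop :=
  exists A : {set 'I_(gn G)},
    (#|A| < nverts F)%N /\
    (exists x y, [/\ x \in A, y \in A & gadj G x y]) /\
    in_M F A /\
    independent (~: A) /\
    exists c0 : 'I_(gn G), forall c, c \in ~: A -> c != c0 ->
      forall a, a \in A -> gadj G c a.

(* Main.v *)
Require Import Defs.
From mathcomp Require Import all_boot all_order all_algebra all_field.
From mathcomp Require Import perm sesquilinear spectral ring lra.
Set Implicit Arguments. Unset Strict Implicit. Unset Printing Implicit Defensive.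
Import Order.TTheory GRing.Theory Num.Theory.
Local Open Scope ring_scope.

(** Let [x] be the unit Perron vector and [lam] the spectral radius, and measure
    vertex sets by [x^2]. Stars are [F]-free, so [lam^2 >= m] for an extremal
    [G]. Choose a subgraph [H] of [G] maximizing [lam(H)^2 - (1 - c) e(H)].
    Deleting a vertex or an edge of [H] does not improve this potential, which
    forces every neighbourhood in [H] to have mass at least about [1/2] and
    [x_u x_v] to be of order at least [1/lam] on every edge.

    If no vertex of [H] is heavy, a greedy Kovari-Sos-Turan argument and
    [F]-freeness show that adjacent vertices have almost disjoint
    neighbourhoods, so [H] is bipartite, hence [lam(H)^2 <= e(H)]; the potential
    then gives [H = G] and equality in Cauchy-Schwarz makes [G] complete
    bipartite.

    If some vertex is heavy, then [H] is exactly a join of a bounded set [A] of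
    heavy vertices with an independent set [B], and [e(H)] differs from [m] by
    [O(sqrt m)]. So the Perron vector of [G] is almost constant on [A] and tiny
    outside. Trading every edge outside [A] for a pendant edge at [A], or moving
    an edge between two vertices not completely joined to [A], would increase
    the spectral radius; these modified graphs are [F]-free because
    [G[A]] is in [M_F]. *)

(** * Perron vectors over the real algebraic numbers *)

(** Extremality of [G] only compares it with graphs of exactly m edges, so it says nothing about
    deletions. The optimal subgraph H is compared with all its own subgraphs instead, and this is
    where local regularity comes from. The discount c keeps H large: [G] has potential at least m -
    (1 - c) m = c m, hence so has H, and lam(H)^2 is at least c m. The almost-bipartite hypothesis
    enters only through one fact: with t = |F|, [F] embeds in K_{t,t} with one edge added inside a
    class. The family M_F works in both directions: a large join forces G[A] into M_F, and
    conversely every graph all of whose edges meet a copy of a subgraph of G[A] is [F]-free, so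
    edges may be rearranged outside [A] at will. The estimates are stated over an arbitrary ordered
    field, hence the comparison of squares throughout; the real algebraic numbers are the instance
    used at the end. *)

Section NbSum.
Variables (R : realFieldType) (T : finType).
Implicit Types (e : rel T) (x y : T -> R) (lam : R).

Definition nbsum e y u := \sum_(v | e u v) y v.

Definition norm2 y := \sum_u y u ^+ 2.

(** Maximality of [lam] is recorded separately by [op_bound]. Entries may vanish, since optimal
    subgraphs can have isolated vertices. *)
Definition perron e lam x :=
  [/\ forall u, 0 <= x u, norm2 x = 1 & forall u, nbsum e x u = lam * x u].

Definition op_bound e lam :=
  forall y, norm2 (nbsum e y) <= lam ^+ 2 * norm2 y.

End NbSum.

Section Spectral.
Local Open Scope sesquilinear_scope.
Variable G : graph.
Let n := gn G.
Let A := adjmx G.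

Lemma adjmx_normal : A \is normalmx.
Proof.
apply: hermitian_normalmx; apply: realsym_hermsym.
  apply/is_hermitianmxP; rewrite expr0 scale1r; apply/matrixP=> i j.
  by rewrite !mxE (@gsym G).
by apply/mxOverP => i j; rewrite mxE realn.
Qed.

Definition sqn (u : 'rV[algC]_n) : algC := \sum_j `|u 0 j| ^+ 2.

Lemma sqnE (u : 'rV[algC]_n) : sqn u = (u *m u ^t*) 0 0.
Proof. by rewrite mxE; apply: eq_bigr => j _; rewrite !mxE normCK. Qed.

Lemma sqn_unitary (u : 'rV[algC]_n) (P : 'M_n) : P \is unitarymx ->
  sqn (u *m P) = sqn u.
Proof.
move=> /unitarymxP hP; rewrite !sqnE trmx_mul map_mxM mulmxA.
by rewrite -[X in (X *m _) 0 0]mulmxA hP mulmx1.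
Qed.

Lemma sqn_op (r : algC) (u : 'rV[algC]_n) : 
  (forall i, `|spectral_diag A 0 i| <= r) -> sqn (u *m A) <= r ^+ 2 * sqn u.
Proof.
move=> hr.
have hU := spectral_unitarymx A.
have /orthomx_spectralP -> := adjmx_normal.
rewrite !mulmxA sqn_unitary //.
have hV : invmx (spectralmx A) \is unitarymx.
  by rewrite invmx_unitary // trmxC_unitary.
rewrite -[in leRHS](sqn_unitary u hV).
set w := u *m _; rewrite /sqn mulr_sumr; apply: ler_sum => j _.
rewrite mul_mx_diag mxE normrM exprMn mulrC ler_wpM2r ?exprn_ge0 //.
by rewrite ler_pXn2r // nnegrE ?normr_ge0 // (le_trans (normr_ge0 _) (hr j)).
Qed.

Lemma spectral_diag_eigen i :
  row i (spectralmx A) *m A = spectral_diag A 0 i *: row i (spectralmx A).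
Proof.
rewrite -row_mul; have /orthomx_spectralP {2}-> := adjmx_normal.
rewrite !mulmxA mulmxV ?spectral_unit // mul1mx.
by apply/rowP=> j; rewrite mul_diag_mx !mxE.
Qed.

Lemma sqn_row i : sqn (row i (spectralmx A)) = 1.
Proof.
have /unitarymxP/matrixP/(_ i i) := spectral_unitarymx A.
rewrite [X in _ = X -> _]mxE eqxx mulr1n => <-.
by rewrite sqnE [LHS]mxE [RHS]mxE; apply: eq_bigr => j _; rewrite !mxE.
Qed.

Lemma adj_mulE (u : 'rV[algC]_n) j : (u *m A) 0 j = \sum_(v | gadj G j v) u 0 v.
Proof.
rewrite mxE [RHS]big_mkcond; apply: eq_bigr => v _; rewrite mxE (@gsym G).
by case: ifP; rewrite ?mulr1 ?mulr0.
Qed.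

(** Let [v] be a unit eigenvector for an eigenvalue of largest modulus r. By the triangle inequality
    its entrywise modulus y satisfies A y >= r y in every coordinate, while |A y| <= r |y| because A
    is normal. So equality holds in every coordinate. *)
Lemma perron_exists : (0 < n)%N -> exists lam : algR, exists x : 'I_n -> algR,
  [/\ spectral_radius G (val lam), 0 <= lam, perron (gadj G) lam x
    & op_bound (gadj G) lam].
Proof.
move=> n0.
pose d i : algR := in_algR (normr_real (spectral_diag A 0 i)).
have [i _ hi] := @Order.TotalTheory.arg_maxP _ algR _ (Ordinal n0) xpredT d erefl.
have hr j : `|spectral_diag A 0 j| <= val (d i) by exact: (hi j erefl).
pose v := row i (spectralmx A).
pose x j : algR := in_algR (normr_real (v 0 j)).
pose y : 'rV[algC]_n := \row_j `|v 0 j|.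
have sqny : sqn y = 1.
  by rewrite -(sqn_row i); apply: eq_bigr => j _; rewrite mxE normr_id.
have v0 : v != 0.
  apply/eqP => v0; have := sqn_row i; rewrite -/v v0 /sqn big1.
    by move/esym/eqP; rewrite oner_eq0.
  by move=> j _; rewrite mxE normr0 expr0n.
have hle j : val (d i) * `|v 0 j| <= (y *m A) 0 j.
  rewrite /= -normrM.
  have -> : spectral_diag A 0 i * v 0 j = (v *m A) 0 j.
    by rewrite spectral_diag_eigen [RHS]mxE.
  rewrite !adj_mulE; apply: le_trans (ler_norm_sum _ _ _) _.
  by apply: ler_sum => k _; rewrite [X in _ <= X]mxE.
have r0 : 0 <= val (d i) by rewrite /=.
have yA k : `|(y *m A) 0 k| = (y *m A) 0 k.
  by apply: ger0_norm; apply: le_trans (hle k); rewrite mulr_ge0.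
have heq j : (y *m A) 0 j = val (d i) * `|v 0 j|.
  have h0 k : 0 <= `|(y *m A) 0 k| ^+ 2 - (val (d i) * `|v 0 k|) ^+ 2.
    by rewrite subr_ge0 ler_pXn2r ?nnegrE ?mulr_ge0 ?normr_ge0 // yA.
  have : \sum_k (`|(y *m A) 0 k| ^+ 2 - (val (d i) * `|v 0 k|) ^+ 2) == 0.
    rewrite eq_le sumr_ge0 ?andbT // big_split /= sumrN subr_le0.
    apply: le_trans (sqn_op y hr) _.
    rewrite /sqn mulr_sumr; apply: ler_sum => k _.
    by rewrite mxE normr_id exprMn.
  rewrite psumr_eq0 // => /allP/(_ j (mem_index_enum _)) /=.
  by rewrite subr_eq0 eqrXn2 ?mulr_ge0 ?normr_ge0 // yA => /eqP.
exists (d i), x; split => //.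
- split.
    exists (spectral_diag A 0 i) => //; apply/eigenvalueP.
    by exists v => //; apply: spectral_diag_eigen.
  move=> l /eigenvalueP [w hw w0].
  have := sqn_op w hr; rewrite hw.
  have -> : sqn (l *: w) = `|l| ^+ 2 * sqn w.
    by rewrite /sqn mulr_sumr; apply: eq_bigr => j _; rewrite mxE normrM exprMn.
  have w1 : 0 < sqn w.
    rewrite lt_def sumr_ge0 ?andbT; last by move=> *; rewrite exprn_ge0.
    apply: contra w0; rewrite psumr_eq0; last by move=> *; rewrite exprn_ge0.
    move=> /allP h; apply/eqP/rowP=> j; rewrite mxE; apply/eqP.
    by have := h j (mem_index_enum _); rewrite /= expf_eq0 /= normr_eq0.
  by rewrite ler_pM2r // ler_pXn2r // ?nnegrE //.
- split=> [u|| u]; first by apply: normr_ge0.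
  + apply: val_inj; rewrite /norm2 [LHS]rmorph_sum [RHS]/= -sqny.
    by apply: eq_bigr => j _; rewrite [LHS]rmorphXn mxE /= normr_id.
  + apply: val_inj; rewrite /nbsum [LHS]rmorph_sum [RHS]/= -heq adj_mulE.
    by apply: eq_bigr => j _; rewrite mxE.
- move=> z.
  pose w : 'rV[algC]_n := \row_j val (z j).
  have := sqn_op w hr.
  have -> : sqn w = val (norm2 z).
    rewrite /norm2 [RHS]rmorph_sum; apply: eq_bigr => j _.
    by rewrite mxE [RHS]rmorphXn /= real_normK ?algRvalP.
  have -> : sqn (w *m A) = val (norm2 (nbsum (gadj G) z)).
    rewrite /norm2 [RHS]rmorph_sum; apply: eq_bigr => j _.
    rewrite [RHS]rmorphXn /= -[in RHS]real_normK ?algRvalP //.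
    rewrite adj_mulE [in RHS]rmorph_sum; congr (`| _ | ^+ 2).
    by apply: eq_bigr => k _; rewrite mxE.
  by [].
Qed.

End Spectral.

(** * Cauchy-Schwarz and masses *)

Section Sums.
Variables (R : realFieldType).

Lemma cauchy_schwarz (I : finType) (P : pred I) (a b : I -> R) :
  (\sum_(i | P i) a i * b i) ^+ 2 <=
  (\sum_(i | P i) a i ^+ 2) * (\sum_(i | P i) b i ^+ 2).
Proof.
set A := \sum_(i | P i) a i ^+ 2; set B := \sum_(i | P i) b i ^+ 2.
set C := \sum_(i | P i) _.
have A0 : 0 <= A by apply: sumr_ge0 => i _; apply: sqr_ge0.
have B0 : 0 <= B by apply: sumr_ge0 => i _; apply: sqr_ge0.
have h : 0 <= A * (A * B - C ^+ 2).
  have -> : A * (A * B - C ^+ 2) = \sum_(i | P i) (A * b i - C * a i) ^+ 2.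
    have -> : \sum_(i | P i) (A * b i - C * a i) ^+ 2 = \sum_(i | P i)
        (A ^+ 2 * b i ^+ 2 + (- 2 * A * C) * (a i * b i) + C ^+ 2 * a i ^+ 2).
      by apply: eq_bigr => i _; ring.
    by rewrite !big_split /= -!mulr_sumr -/A -/B -/C; ring.
  by apply: sumr_ge0 => i _; apply: sqr_ge0.
have [A1|A1] := eqVneq A 0; last first.
  have Ap : 0 < A by rewrite lt_def A1.
  by rewrite pmulr_rge0 // subr_ge0 in h.
have -> : C = 0.
  apply: big1 => i Pi; move/eqP: A1; rewrite psumr_eq0 => [|j _]; last exact: sqr_ge0.
  move=> /allP/(_ i (mem_index_enum _)); rewrite Pi /= sqrf_eq0 => /eqP ->.
  by rewrite mul0r.
by rewrite expr0n mulr_ge0.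
Qed.

Variable (T : finType).
Implicit Types (e : rel T) (x y : T -> R) (lam : R) (S : {set T}).

Definition nb e u : {set T} := [set v | e u v].

Definition mass x S := \sum_(v in S) x v ^+ 2.

Lemma nbsumE e y u : nbsum e y u = \sum_(v in nb e u) y v.
Proof. by apply: eq_bigl => v; rewrite inE. Qed.

Lemma sum_sqr_le_mass S x : (\sum_(v in S) x v) ^+ 2 <= #|S|%:R * mass x S.
Proof.
have := cauchy_schwarz (mem S) (fun=> 1) x.
under eq_bigr do rewrite mul1r.
by under [X in _ <= X * _]eq_bigr do rewrite expr1n; rewrite sumr_const.
Qed.

Lemma mass_ge0 x S : 0 <= mass x S.
Proof. by apply: sumr_ge0 => i _; apply: sqr_ge0. Qed.

Lemma mass_setID x S S' : mass x S = mass x (S :&: S') + mass x (S :\: S').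
Proof. exact: big_setID. Qed.

Lemma mass_sub x S S' : S \subset S' -> mass x S <= mass x S'.
Proof.
by move=> /setIidPr h; rewrite (mass_setID x S' S) h lerDl mass_ge0.
Qed.

Lemma mass_setUI x S S' :
  mass x (S :|: S') + mass x (S :&: S') = mass x S + mass x S'.
Proof.
rewrite (mass_setID x (S :|: S') S) setUK setDUl setDv set0U.
by rewrite (mass_setID x S' S) (setIC S'); ring.
Qed.

Lemma mass_setT x : mass x [set: T] = norm2 x.
Proof. by apply: eq_bigl => v; rewrite inE. Qed.

Lemma mass_le_norm2 x S : mass x S <= norm2 x.
Proof. by rewrite -mass_setT mass_sub. Qed.

Lemma mass_mem x S v : v \in S -> x v ^+ 2 <= mass x S.
Proof.
by move=> vS; rewrite /mass (bigD1 v) //= lerDl sumr_ge0 // => i _; apply: sqr_ge0.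
Qed.

Lemma norm2_ge0 x : 0 <= norm2 x.
Proof. by rewrite -mass_setT mass_ge0. Qed.

Lemma exchange_nb e (f : T -> T -> R) : symmetric e ->
  \sum_u \sum_(v | e u v) f u v = \sum_u \sum_(v | e u v) f v u.
Proof.
move=> es; rewrite (exchange_big_dep xpredT) //=; apply: eq_bigr => u _.
by apply: eq_bigl => v; rewrite es.
Qed.

Lemma op_bound_rayleigh e lam y : 0 <= lam -> op_bound e lam ->
  \sum_u y u * nbsum e y u <= lam * norm2 y.
Proof.
move=> l0 h; have n0 := norm2_ge0 y.
have := cauchy_schwarz xpredT y (nbsum e y); have := h y.
rewrite -/(norm2 y) -/(norm2 (nbsum e y)); set q := \sum_u _.
move=> h1 h2; have h3 : q ^+ 2 <= (lam * norm2 y) ^+ 2.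
  by apply: le_trans h2 _; rewrite exprMn expr2 mulrCA ler_wpM2l // mulrCA -expr2 mulrC.
rewrite leNgt; apply/negP => h4; have h5 : 0 <= lam * norm2 y by rewrite mulr_ge0.
nra.
Qed.

Section Perron.
Variables (e : rel T) (lam : R) (x : T -> R).
Hypothesis (es : symmetric e) (hx : perron e lam x).

Lemma perron_ge0 u : 0 <= x u. Proof. by case: hx. Qed.

Lemma perron_norm : norm2 x = 1. Proof. by case: hx. Qed.

Lemma perron_eq u : nbsum e x u = lam * x u. Proof. by case: hx. Qed.

Lemma perron_mass_le1 S : mass x S <= 1.
Proof. by rewrite -perron_norm mass_le_norm2. Qed.

Lemma perron_le1 u : x u <= 1.
Proof.
have := perron_mass_le1 [set u]; rewrite /mass big_set1 => h.
have := perron_ge0 u; nra.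
Qed.

Lemma perron_qf : \sum_u x u * nbsum e x u = lam.
Proof.
transitivity (lam * norm2 x); last by rewrite perron_norm mulr1.
by rewrite /norm2 mulr_sumr; apply: eq_bigr => u _; rewrite perron_eq; ring.
Qed.

(** Cauchy-Schwarz in the eigenvalue equation at [u]. An upper bound on the degree of order lam^2
    x_u^2 turns it into a lower bound on the mass of the neighbourhood. *)
Lemma perron_deg u : lam ^+ 2 * x u ^+ 2 <= #|nb e u|%:R * mass x (nb e u).
Proof.
by rewrite -exprMn -perron_eq nbsumE; apply: sum_sqr_le_mass.
Qed.

End Perron.

(** For symmetric irreflexive [e] this is twice the number of edges, whence the factors (1 - c) / 2
    in the potential below. *)
Definition degsum e : nat := (\sum_u #|nb e u|)%N.

Lemma perron_sqr_le e lam x : perron e lam x -> lam ^+ 2 <= (degsum e)%:R.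
Proof.
move=> hx; have -> : lam ^+ 2 = \sum_u lam ^+ 2 * x u ^+ 2.
  by rewrite -mulr_sumr -/(norm2 x) (perron_norm hx) mulr1.
rewrite /degsum natr_sum; apply: ler_sum => u _; apply: le_trans (perron_deg hx u) _.
by rewrite ler_piMr // (perron_mass_le1 hx).
Qed.

Lemma sum_nb_const e (a : R) : \sum_u \sum_(v | e u v) a = (degsum e)%:R * a.
Proof.
rewrite /degsum natr_sum mulr_suml; apply: eq_bigr => u _.
by rewrite sumr_const mulr_natl; congr (_ *+ _); apply: eq_card => v; rewrite !inE.
Qed.

End Sums.

(** * Consequences of optimality under deletion *)

Section Opt.
Variables (R : realFieldType) (T : finType).
Implicit Types (e : rel T) (x y : T -> R) (lam : R) (S : {set T}).

(** Each edge counts in both directions, so f = y_u y_v gives the quadratic form of the adjacency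
    matrix. *)
Definition arcsum e (f : T -> T -> R) := \sum_u \sum_(v | e u v) f u v.

Lemma arcsum1 e : (degsum e)%:R = arcsum e (fun _ _ => 1).
Proof. by rewrite /arcsum sum_nb_const mulr1. Qed.

Lemma arcsum_split e e' e'' f :
  (forall u v, e' u v -> e u v) -> (forall u v, e'' u v = e u v && ~~ e' u v) ->
  arcsum e f = arcsum e' f + arcsum e'' f.
Proof.
move=> h1 h2; rewrite /arcsum -big_split; apply: eq_bigr => u _ /=.
rewrite (bigID (e' u)) /=; congr (_ + _); apply: eq_bigl => v; last by rewrite h2.
by case h : (e' u v); rewrite ?andbF // (h1 _ _ h).
Qed.

Lemma arcsum_pair a b f : a != b ->
  arcsum (fun u v => ((u == a) && (v == b)) || ((u == b) && (v == a))) f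
  = f a b + f b a.
Proof.
move=> ab; rewrite /arcsum (bigD1 a) //= [X in _ + X](bigD1 b) ?(eq_sym b) //=.
rewrite [X in _ + (_ + X)]big1 ?addr0 => [|u /andP[/negPf h1 /negPf h2]]; last first.
  by rewrite big_pred0 // => v; rewrite h1 h2.
congr (_ + _).
  by rewrite (big_pred1 b) // => v /=; rewrite eqxx (negPf ab) orbF.
by rewrite (big_pred1 a) // => v /=; rewrite eqxx (negPf ab).
Qed.

Lemma arcsum_star e w f : symmetric e -> irreflexive e ->
  arcsum (fun u v => e u v && ((u == w) || (v == w))) f
  = \sum_(v | e w v) f w v + \sum_(v | e w v) f v w.
Proof.
move=> es ei; rewrite /arcsum (bigD1 w) //=; congr (_ + _).
  by apply: eq_bigl => v; rewrite eqxx andbT.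
rewrite [RHS](eq_bigl (fun v => (v != w) && e w v)); last first.
  by move=> v; case: eqP => // ->; rewrite ei.
rewrite [RHS]big_mkcondr; apply: eq_bigr => u /negPf uw.
rewrite [LHS](eq_bigl (fun v => e w u && (v == w))); last first.
  by move=> v /=; rewrite uw /=; case: (eqVneq v w) => [->|]; rewrite ?andbF // es.
by case: (e w u); rewrite ?big_pred1_eq ?big_pred0.
Qed.

Definition del_vertex e w : rel T := fun u v => [&& e u v, u != w & v != w].

Definition del_edge e a b : rel T :=
  fun u v => e u v && ~~ (((u == a) && (v == b)) || ((u == b) && (v == a))).

Lemma degsum_del_vertex e w : symmetric e -> irreflexive e ->
  (degsum e)%:R = (degsum (del_vertex e w))%:R + 2 * #|nb e w|%:R :> R.
Proof.
move=> es ei; rewrite !arcsum1.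
rewrite (@arcsum_split e (del_vertex e w) (fun u v => e u v && ((u == w) || (v == w)))).
- rewrite arcsum_star // sumr_const.
  rewrite (eq_card (_ : _ =i nb e w)); last by move=> v; rewrite !inE.
  by ring.
- by move=> u v /and3P[].
- by move=> u v; rewrite /del_vertex; case: (e u v); rewrite //= negb_and !negbK.
Qed.

Lemma arcsum_del_edge e a b f : symmetric e -> irreflexive e -> e a b ->
  arcsum e f = arcsum (del_edge e a b) f + (f a b + f b a).
Proof.
move=> es ei ab.
have anb : a != b by apply: contraTneq ab => ->; rewrite ei.
rewrite -(arcsum_pair _ anb); apply: arcsum_split => u v; first by case/andP.
rewrite /del_edge; case: (boolP (_ || _)); rewrite /= ?andbF ?andbT ?andbN //.
by case/orP => /andP[/eqP-> /eqP->]; rewrite ?ab // es ab.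
Qed.

Lemma degsum_del_edge e a b : symmetric e -> irreflexive e -> e a b ->
  (degsum e)%:R = (degsum (del_edge e a b))%:R + 2 :> R.
Proof. by move=> es ei ab; rewrite !arcsum1 (arcsum_del_edge _ es ei ab); ring. Qed.

(* Bounding [|A' y|^2] instead of [y^T A' y] makes the constant 2 in
   [optimal_vertex] exact even when [w] is heavy. *)
Lemma del_vertex_bound e lam lam' x w : symmetric e -> irreflexive e ->
  perron e lam x -> op_bound (del_vertex e w) lam' ->
  lam ^+ 2 * (1 - 3 * x w ^+ 2) + #|nb e w|%:R * x w ^+ 2
    <= lam' ^+ 2 * (1 - x w ^+ 2).
Proof.
move=> es ei hx hop; pose y u := if u == w then 0 else x u.
have hn : norm2 y = 1 - x w ^+ 2.
  rewrite -(perron_norm hx) /norm2 (bigD1 w) //= [in RHS](bigD1 w) //=.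
  rewrite /y eqxx expr0n /= add0r [RHS]addrC addKr; apply: eq_bigr => u /negPf ->.
  by [].
have := hop y; rewrite hn; apply: le_trans.
have hs u : u != w -> nbsum (del_vertex e w) y u =
    lam * x u - (if e w u then x w else 0).
  move=> uw; rewrite -(perron_eq hx) /nbsum [in RHS](bigID (pred1 w)) /=.
  rewrite [X in X + _ - _](_ : _ = if e w u then x w else 0); last first.
    rewrite (eq_bigl (fun v => e w u && (v == w))); last first.
      by move=> v /=; case: (eqVneq v w) => [->|]; rewrite ?andbF // es.
    by case: (e w u); rewrite ?big_pred1_eq ?big_pred0.
  rewrite [RHS]addrC addKr; apply: eq_big => v; rewrite /del_vertex ?uw //=.
  by case/andP => _ /negPf h; rewrite /y h.
rewrite /norm2 (bigD1 w) //= -[leLHS]add0r; apply: lerD; first exact: sqr_ge0.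
(* The cross terms sum to -2 lam^2 x_w^2 by the eigenvalue equation at [w]; together with the
   dropped coordinate [w] this makes the factor 3. *)
rewrite (eq_bigr (fun u => lam ^+ 2 * x u ^+ 2 - 2 * lam * x w * (if e w u then x u else 0)
    + (if e w u then x w ^+ 2 else 0))); last first.
  by move=> u uw; rewrite hs //; case: (e w u); ring.
rewrite !big_split /= -mulr_sumr sumrN -mulr_sumr.
have -> : \sum_(i | i != w) x i ^+ 2 = 1 - x w ^+ 2.
  by rewrite -(perron_norm hx) /norm2 [in RHS](bigD1 w) //= [RHS]addrC addKr.
rewrite -!big_mkcondr /=.
have hp u : (u != w) && e w u = e w u by case: eqP => // ->; rewrite ei.
rewrite !(eq_bigl _ _ hp) -/(nbsum e x w) (perron_eq hx) sumr_const.
rewrite (eq_card (_ : _ =i nb e w)); last by move=> v; rewrite !inE.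
rewrite -[X in _ <= _ + X]mulr_natl le_eqVlt; apply/orP; left; apply/eqP; ring.
Qed.

Lemma perron_arcsum e lam x : perron e lam x -> arcsum e (fun u v => x u * x v) = lam.
Proof.
move=> hx; rewrite -[RHS](perron_qf hx); apply: eq_bigr => u _.
by rewrite /nbsum mulr_sumr.
Qed.

Lemma rayleigh_arcsum e lam y : 0 <= lam -> op_bound e lam ->
  arcsum e (fun u v => y u * y v) <= lam * norm2 y.
Proof.
move=> l0 h; apply: le_trans (op_bound_rayleigh y l0 h); rewrite le_eqVlt.
by apply/orP; left; apply/eqP; apply: eq_bigr => u _; rewrite /nbsum mulr_sumr.
Qed.

(** The arcs at [w] alone contribute 2 lam x_w^2 to the quadratic form, whose value is lam. *)
Lemma perron_half e lam x w : symmetric e -> irreflexive e -> 0 < lam ->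
  perron e lam x -> x w ^+ 2 <= 1 / 2.
Proof.
move=> es ei l0 hx.
have h : arcsum (fun u v => e u v && ((u == w) || (v == w))) (fun u v => x u * x v) <= lam.
  rewrite -[leRHS](perron_arcsum hx) (@arcsum_split e
    (fun u v => e u v && ((u == w) || (v == w))) (del_vertex e w)).
  - rewrite lerDl /arcsum; apply: sumr_ge0 => u _; apply: sumr_ge0 => v _.
    by apply: mulr_ge0; apply: perron_ge0 hx _.
  - by move=> u v /andP[].
  - by move=> u v; rewrite /del_vertex; case: (e u v); rewrite //= negb_or.
rewrite arcsum_star // -mulr_sumr -mulr_suml -/(nbsum e x w) (perron_eq hx) in h.
have : lam * (2 * x w ^+ 2) <= lam * 1 by rewrite mulr1; apply: le_trans h; lra.
by rewrite ler_pM2l //; lra.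
Qed.

Section Optimal.
Variables (e : rel T) (lam c : R) (x : T -> R).
Hypotheses (es : symmetric e) (ei : irreflexive e) (l0 : 0 < lam).
Hypotheses (hx : perron e lam x) (c0 : 0 <= c) (c1 : c <= 1 / 2).
Hypothesis hopt : forall e', symmetric e' -> (forall u v, e' u v -> e u v) ->
  exists lam', [/\ 0 <= lam', op_bound e' lam' &
    lam' ^+ 2 - (1 - c) / 2 * (degsum e')%:R <= lam ^+ 2 - (1 - c) / 2 * (degsum e)%:R].

(** Optimality gives lam'^2 <= lam^2 - (1 - c) d after deleting [w] of degree d. Inserted in
    [del_vertex_bound], the terms in d x_w^2 cancel up to c d x_w^2, which has the right sign. *)
Lemma optimal_vertex w : (1 - c) * #|nb e w|%:R <= 2 * lam ^+ 2 * x w ^+ 2.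
Proof.
have [||lam' [l'0 hop hle]] := @hopt (del_vertex e w).
- by move=> u v; rewrite /del_vertex es [(u != w) && _]andbC.
- by move=> u v /and3P[].
have := del_vertex_bound es ei hx hop.
have := perron_half w es ei l0 hx.
move: hle; rewrite (degsum_del_vertex w es ei).
have d0 : 0 <= #|nb e w|%:R :> R by apply: ler0n.
have p0 := sqr_ge0 (x w).
move: (x w ^+ 2) p0 (#|nb e w|%:R) d0 => p p0 d d0.
move: (lam ^+ 2) (lam' ^+ 2) (degsum _)%:R => L L' E h1 h2 h3.
have h4 : L' <= L - (1 - c) * d by lra.
have h5 : 0 <= 1 - p by lra.
have h6 := ler_wpM2r h5 h4.
have h7 : 0 <= c * (d * p) by rewrite !mulr_ge0.
lra.
Qed.

(** Testing the smaller graph with the old [x] gives lam' >= lam - 2 x_u x_v, while optimality gives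
    lam'^2 <= lam^2 - (1 - c). With c at most 1/2 this yields the constant 8. *)
Lemma optimal_edge u v : e u v -> 1 <= 8 * lam * (x u * x v).
Proof.
move=> uv; have [||lam' [l'0 hop hle]] := @hopt (del_edge e u v).
- by move=> a b; rewrite /del_edge es orbC [(a == v) && _]andbC [(a == u) && _]andbC.
- by move=> a b /andP[].
have := rayleigh_arcsum x l'0 hop; rewrite (perron_norm hx) mulr1.
have := arcsum_del_edge (fun u v => x u * x v) es ei uv.
rewrite (perron_arcsum hx) => h1 h2.
move: hle; rewrite (degsum_del_edge es ei uv) => h3.
have h4 : 0 <= x u * x v by apply: mulr_ge0; apply: perron_ge0 hx _.
have h5 : lam - 2 * (x u * x v) <= lam' by lra.
(* Needed before squaring: this is the quadratic form of the remaining edges. *)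
have h6 : 0 <= lam - 2 * (x u * x v).
  have -> : lam - 2 * (x u * x v) = arcsum (del_edge e u v) (fun u v => x u * x v) by lra.
  apply: sumr_ge0 => a _; apply: sumr_ge0 => b _.
  by apply: mulr_ge0; apply: perron_ge0 hx _.
have h7 : (lam - 2 * (x u * x v)) ^+ 2 <= lam' ^+ 2 by rewrite ler_pXn2r ?nnegrE.
have h8 := sqr_ge0 (x u * x v).
move: (x u * x v) h4 h7 h8 => q h4 h7 h8.
have h9 : lam' ^+ 2 <= lam ^+ 2 - (1 - c) by lra.
have h10 : lam ^+ 2 - 4 * (lam * q) + 4 * q ^+ 2 <= lam' ^+ 2 by lra.
have := c1; lra.
Qed.

End Optimal.
End Opt.

(** * Bipartite graphs and the spread case *)

Section Bipartite.
Variables (R : realFieldType) (T : finType).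
Implicit Types (e : rel T) (x y : T -> R) (lam : R) (S : {set T}).

Lemma arcsum_ge0 e (f : T -> T -> R) : (forall u v, 0 <= f u v) -> 0 <= arcsum e f.
Proof. by move=> h; apply: sumr_ge0 => u _; apply: sumr_ge0. Qed.

Lemma arcsum_mem e (f : T -> T -> R) a b :
  (forall u v, 0 <= f u v) -> e a b -> f a b <= arcsum e f.
Proof.
move=> h ab; rewrite /arcsum (bigD1 a) //= (bigD1 b) //= -addrA lerDl.
by rewrite addr_ge0 ?sumr_ge0 // => u _; rewrite sumr_ge0.
Qed.

Variables (e : rel T) (lam : R) (x : T -> R) (col : T -> bool).
Hypothesis (l0 : 0 < lam) (hx : perron e lam x).
Hypothesis (hcol : forall u v, e u v -> col u != col v).

(** Over all pairs with different colours, x_u^2 x_v^2 sums to 2 a b with a + b = 1, hence to at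
    most 1/2; expanding the square does the rest. The left side measures the distance from a
    complete bipartite graph with x_u x_v = th on every edge. *)
Lemma bipartite_excess th :
  arcsum e (fun u v => (x u * x v - th) ^+ 2) +
  arcsum (fun u v => (col u != col v) && ~~ e u v) (fun u v => x u ^+ 2 * x v ^+ 2)
  <= 1 / 2 - 2 * th * lam + th ^+ 2 * (degsum e)%:R.
Proof.
have -> : arcsum e (fun u v => (x u * x v - th) ^+ 2) =
   arcsum e (fun u v => x u ^+ 2 * x v ^+ 2) - 2 * th * lam + th ^+ 2 * (degsum e)%:R.
  rewrite arcsum1 -{1}(perron_arcsum hx) /arcsum !mulr_sumr -sumrB -big_split.
  apply: eq_bigr => u _; rewrite !mulr_sumr -sumrB -big_split.
  by apply: eq_bigr => v _ /=; ring.
have := @arcsum_split _ _ (fun u v => col u != col v) e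
  (fun u v => (col u != col v) && ~~ e u v) (fun u v => x u ^+ 2 * x v ^+ 2) hcol
  (fun u v => erefl _).
have -> : arcsum (fun u v => col u != col v) (fun u v => x u ^+ 2 * x v ^+ 2) =
    2 * (\sum_(u | col u) x u ^+ 2) * (\sum_(u | ~~ col u) x u ^+ 2).
  rewrite /arcsum (bigID col) /= [in X in _ + X = _](eq_bigr (fun u =>
     x u ^+ 2 * \sum_(v | col v) x v ^+ 2)); last first.
    move=> u /negPf h; rewrite mulr_sumr; apply: eq_bigl => v.
    by rewrite h; case: (col v).
  rewrite [in X in X + _ = _](eq_bigr (fun u =>
     x u ^+ 2 * \sum_(v | ~~ col v) x v ^+ 2)); last first.
    move=> u h; rewrite mulr_sumr; apply: eq_bigl => v.
    by rewrite h; case: (col v).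
  by rewrite -!mulr_suml; ring.
have := perron_norm hx; rewrite /norm2 (bigID col) /=.
move: (\sum_(u | col u) _) (\sum_(u | ~~ col u) _) => a b h1 h2.
have h3 : 2 * a * b <= 1 / 2.
  have -> : b = 1 - a by lra.
  by have := sqr_ge0 (a - 1 / 2); lra.
lra.
Qed.

Lemma bipartite_sqr_le : 2 * lam ^+ 2 <= (degsum e)%:R.
Proof.
(* This value of [th] minimizes the right-hand side. *)
have := bipartite_excess (lam / (degsum e)%:R).
have h1 := perron_sqr_le hx.
set N : R := (degsum e)%:R in h1 *.
have N0 : 0 < N by apply: lt_le_trans h1; rewrite exprn_gt0.
have -> : (lam / N) ^+ 2 * N = lam ^+ 2 / N by field; lra.
have -> : 2 * (lam / N) * lam = 2 * (lam ^+ 2 / N) by ring.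
have := @arcsum_ge0 e (fun u v => (x u * x v - lam / N) ^+ 2) (fun u v => sqr_ge0 _).
have h2 : 0 <= arcsum (fun u v => (col u != col v) && ~~ e u v) (fun u v => x u ^+ 2 * x v ^+ 2).
  by apply: arcsum_ge0 => u v; rewrite mulr_ge0 ?sqr_ge0.
move=> h3 h4; have : lam ^+ 2 / N <= 1 / 2 by lra.
rewrite ler_pdivrMr //; lra.
Qed.

(** At th = 1 / (2 lam) the right-hand side of [bipartite_excess] is at most 0, so both sums vanish.
    The first makes [x] positive at every non-isolated vertex, and then a missing pair would make
    the second positive. *)
Lemma bipartite_complete : (degsum e)%:R <= 2 * lam ^+ 2 ->
  (forall u, exists v, e u v) -> forall u v, e u v = (col u != col v).
Proof.
move=> hN noiso; have l0' := l0.
have := bipartite_excess (1 / (2 * lam)); set th := 1 / (2 * lam).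
have -> : 2 * th * lam = 1 by rewrite /th; field; lra.
have h1 : th ^+ 2 * (degsum e)%:R <= 1 / 2.
  have -> : 1 / 2 = th ^+ 2 * (2 * lam ^+ 2) by rewrite /th; field; lra.
  by rewrite ler_wpM2l ?sqr_ge0.
have t0 : 0 < th by rewrite /th divr_gt0 // mulr_gt0.
have p0 (u v : T) : 0 <= x u ^+ 2 * x v ^+ 2 by rewrite mulr_ge0 ?sqr_ge0.
move=> h2.
have x0 u : 0 < x u.
  have [v uv] := noiso u.
  have := arcsum_mem (fun u v => sqr_ge0 (x u * x v - th)) uv.
  have := @arcsum_ge0 (fun u v => (col u != col v) && ~~ e u v) _ p0.
  move=> h3 h4; have h5 : (x u * x v - th) ^+ 2 = 0.
    by apply/eqP; rewrite eq_le sqr_ge0 andbT; lra.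
  rewrite lt_def (perron_ge0 hx) andbT; apply/eqP => xu.
  by move: h5; rewrite xu mul0r sub0r sqrrN; have := exprn_gt0 2 t0; lra.
move=> u v; apply/idP/idP => [/hcol //|uv]; apply: contraT => nuv.
have := @arcsum_mem (fun u v => (col u != col v) && ~~ e u v) _ u v p0.
rewrite uv nuv => /(_ erefl).
have := @arcsum_ge0 e (fun u v => (x u * x v - th) ^+ 2) (fun u v => sqr_ge0 _).
have : 0 < x u ^+ 2 * x v ^+ 2 by rewrite mulr_gt0 ?exprn_gt0.
lra.
Qed.

End Bipartite.

(** * The spread case: no vertex carries much mass *)

Section NoAtoms.
Variables (R : realFieldType) (T : finType) (e : rel T) (lam : R) (x : T -> R).
Hypotheses (es : symmetric e) (ei : irreflexive e) (hx : perron e lam x).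

Definition commonnb (Z : {set T}) : {set T} := [set v | [forall z in Z, e z v]].

Lemma commonnbU1 z Z : commonnb (z |: Z) = nb e z :&: commonnb Z.
Proof.
apply/setP=> v; rewrite !inE; apply/forall_inP/andP => [h|[h1 /forall_inP h2] w].
  split; first by apply: h; rewrite !inE eqxx.
  by apply/forall_inP => w wZ; apply: h; rewrite !inE wZ orbT.
by rewrite !inE => /orP[/eqP->|/h2].
Qed.

Lemma sum_mass_nb (Y : {set T}) :
  \sum_z x z ^+ 2 * mass x (nb e z :&: Y) = \sum_(w in Y) x w ^+ 2 * mass x (nb e w).
Proof.
under eq_bigr do rewrite /mass mulr_sumr.
rewrite (exchange_big_dep (mem Y)) /=; last by move=> z w _; rewrite inE => /andP[].
apply: eq_bigr => w wY; rewrite /mass mulr_sumr; apply: eq_big => z.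
  by rewrite !inE wY andbT es.
by move=> _; rewrite mulrC.
Qed.

(** Vertices join [Z] one at a time, each keeping a sixth of the current common neighbourhood W. The
    average of mass(N(z) in W) with weights x_z^2 is at least mass(W) / 3; members of [Z] account
    for at most a twelfth, and if every other vertex kept less than a sixth the total would not
    exceed a quarter. *)
Lemma kovari_sos_turan_greedy (t : nat) (eps : R) (Y : {set T}) k : (k <= t)%N ->
  (forall v, x v ^+ 2 <= eps) -> t%:R * eps <= 1 / 12 ->
  (forall w, w \in Y -> 1 / 3 <= mass x (nb e w)) ->
  exists2 Z : {set T}, #|Z| = k & mass x Y <= 6 ^+ k * mass x (commonnb Z :&: Y).
Proof.
move=> kt heps hte hY; elim: k kt => [|k IH] kt.
  exists set0; rewrite ?cards0 // expr0 mul1r mass_sub //.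
  by apply/subsetP => v vY; rewrite !inE vY andbT; apply/forall_inP => z; rewrite inE.
have [Z hZ hm] := IH (ltnW kt).
set W := commonnb Z :&: Y in hm.
have [/existsP[z /andP[zZ hz]]|/existsPn hno] :=
    boolP [exists z, (z \notin Z) && (mass x W <= 6 * mass x (nb e z :&: W))].
  exists (z |: Z); first by rewrite cardsU1 zZ hZ.
  rewrite commonnbU1 -setIA -/W exprS -mulrA mulrCA.
  apply: le_trans hm _; rewrite ler_wpM2l // exprn_ge0 //; lra.
have hs := sum_mass_nb W.
have h1 : mass x W / 3 <= \sum_(w in W) x w ^+ 2 * mass x (nb e w).
  rewrite {1}/mass mulr_suml; apply: ler_sum => w; rewrite inE => /andP[_ wY].
  by rewrite ler_wpM2l ?sqr_ge0 //; have := hY w wY; lra.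
have eps0 : 0 <= eps.
  have h : 0 < norm2 x by rewrite (perron_norm hx).
  have [v] : exists v : T, true.
    case: (pickP (@predT T)) => [v _|h0]; first by exists v.
    by move: h; rewrite /norm2 big_pred0 ?ltxx.
  by move=> _; apply: le_trans (heps v); apply: sqr_ge0.
have W0 := mass_ge0 x W.
(* Averaging says nothing when W has mass 0, but then any new vertex will do; one exists because [Z]
   has mass at most 1/12. *)
have [Wz|Wn] := eqVneq (mass x W) 0.
  have Y0 : mass x Y = 0.
    by apply/eqP; rewrite eq_le mass_ge0 andbT; move: hm; rewrite Wz mulr0.
  have [z zZ] : exists z : T, z \notin Z.
    apply/existsP; apply: contraT => /existsPn h.
    have h' : Z = setT by apply/setP=> v; rewrite !inE; apply/negPn/h.
    have : norm2 x <= k%:R * eps.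
      rewrite -hZ h' -mass_setT mulr_natl -sumr_const.
      by apply: ler_sum => v _.
    rewrite (perron_norm hx); have : k%:R * eps <= t%:R * eps.
      by rewrite ler_wpM2r // ler_nat ltnW.
    by lra.
  exists (z |: Z); first by rewrite cardsU1 zZ hZ.
  by rewrite Y0 mulr_ge0 ?mass_ge0 // exprn_ge0.
have {}Wn : 0 < mass x W by rewrite lt_def Wn.
have h2 : \sum_z x z ^+ 2 * mass x (nb e z :&: W) <=
    (\sum_(z in Z) eps * mass x W) + \sum_(z | z \notin Z) x z ^+ 2 * (mass x W / 6).
  rewrite (bigID (mem Z)) /=; apply: lerD; apply: ler_sum => z zZ.
    by rewrite ler_pM ?sqr_ge0 ?mass_ge0 // mass_sub // subsetIr.
  rewrite ler_wpM2l ?sqr_ge0 //; have := hno z; rewrite zZ /= -ltNge.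
  by lra.
have h3 : \sum_(z | z \notin Z) x z ^+ 2 * (mass x W / 6) <= mass x W / 6.
  rewrite -mulr_suml ler_piMl //; first by lra.
  have := perron_mass_le1 hx (~: Z); rewrite /mass.
  by under eq_bigl do rewrite inE.
have h4 : \sum_(z in Z) eps * mass x W <= mass x W / 12.
  rewrite sumr_const hZ -[leLHS]mulr_natl mulrA mulrC ler_wpM2l //.
  by apply: le_trans (_ : t%:R * eps <= _); [rewrite ler_wpM2r // ler_nat ltnW | lra].
by exfalso; lra.
Qed.

Lemma mass_overlap (A B P : {set T}) :
  mass x (A :&: P) + mass x (B :&: P) <= mass x P + mass x (A :&: B).
Proof.
rewrite -mass_setUI; apply: lerD; apply: mass_sub.
  by rewrite subUset !subsetIr.
by apply: setISS; rewrite subsetIl.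
Qed.

(** The part of [A] outside the union of [P] and [Q] has mass at most 1 - mass([P :|: Q]). *)
Lemma mass_cover (A P Q : {set T}) :
  mass x A + mass x (P :|: Q) <= mass x (A :&: P) + mass x (A :&: Q) + 1.
Proof.
have := mass_setID x A (P :|: Q); have := mass_setUI x (A :&: P) (A :&: Q).
rewrite -setIUr.
have := mass_setUI x (A :\: (P :|: Q)) (P :|: Q).
have -> : (A :\: (P :|: Q)) :&: (P :|: Q) = set0.
  by apply/setP => v; rewrite !inE; case: (v \in P); case: (v \in Q); rewrite ?andbF.
have := perron_mass_le1 hx ((A :\: (P :|: Q)) :|: (P :|: Q)).
have := mass_ge0 x ((A :&: P) :&: (A :&: Q)); have := mass_ge0 x set0.
have -> : mass x set0 = 0 by rewrite /mass big_set0.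
lra.
Qed.

(* No copy of K_{t,t} with an extra edge inside one class. *)
Definition Kplus_free (t : nat) := forall (U W : {set T}) a b,
  (t <= #|U|)%N -> (t <= #|W|)%N -> a \in U -> b \in U -> e a b ->
  (forall u w, u \in U -> w \in W -> e u w) -> False.

Variables (t : nat) (eps : R).
Hypotheses (hfree : Kplus_free t) (heps : forall v, x v ^+ 2 <= eps).
Hypotheses (hte : t%:R * eps <= 1 / 12) (hte' : 6 ^+ t * (t%:R * eps) < 1 / 100).
Hypothesis hnb : forall u v, e u v -> 99 / 200 <= mass x (nb e u).

(** Otherwise the greedy lemma inside the common neighbourhood yields t vertices [Z] whose common
    neighbours W there have mass above t eps, hence number at least t. Then [u], [v] and [Z] against
    W, with the edge [u v], are forbidden. *)
Lemma codeg_small u v : e u v -> mass x (nb e u :&: nb e v) < 1 / 100.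
Proof.
move=> uv; rewrite ltNge; apply/negP => hY.
have [|Z hZ hm] := kovari_sos_turan_greedy (leqnn t) heps hte (Y := nb e u :&: nb e v).
  move=> w; rewrite !inE => /andP[uw _].
  by have := @hnb w u; rewrite es => /(_ uw); lra.
set W := commonnb Z :&: _ in hm.
apply: (hfree (U := [set u; v] :|: Z) (W := W) (a := u) (b := v)) => //.
- by rewrite -hZ subset_leq_card // subsetUr.
- rewrite leqNgt; apply/negP => Wt; have hle : mass x W <= t%:R * eps.
    apply: le_trans (_ : #|W|%:R * eps <= _).
      by rewrite mulr_natl -sumr_const; apply: ler_sum.
    rewrite ler_wpM2r ?ler_nat 1?ltnW //.
    by apply: le_trans (heps u); apply: sqr_ge0.
  have h6 : 0 <= 6 ^+ t :> R by rewrite exprn_ge0.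
  have := ler_wpM2l h6 hle; have := hte'; lra.
- by rewrite !inE eqxx.
- by rewrite !inE eqxx orbT.
move=> a w; rewrite !inE => ha /and3P[/forall_inP hc uw vw].
by case/orP: ha => [/orP[/eqP->|/eqP->]|/hc].
Qed.

(** Neighbourhoods of adjacent vertices are almost disjoint and have mass about 1/2, so those of one
    edge [a b] almost partition the mass into P and Q. A vertex is coloured by whether it has a
    neighbour in P; its neighbourhood then lies mostly in P, respectively in Q. Adjacent vertices of
    the same colour would have overlapping neighbourhoods. *)
Lemma no_atoms_bipartite : exists col : T -> bool, forall u v, e u v -> col u != col v.
Proof.
have [/existsP[a /existsP[b ab]]|/existsPn hno] := boolP [exists a, exists b, e a b]; last first.
  by exists xpredT => u v uv; have /existsPn/(_ v) := hno u; rewrite uv.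
have ba : e b a by rewrite es.
set P := nb e a; set Q := nb e b.
have hPQ : mass x (P :&: Q) < 1 / 100 by apply: codeg_small.
have hP : 99 / 200 <= mass x P by apply: hnb ab.
have hQ : 99 / 200 <= mass x Q by apply: hnb ba.
have hU := mass_setUI x P Q.
have hU1 := perron_mass_le1 hx (P :|: Q).
(* A neighbour q of the centre c has little of its neighbourhood in P', so at least 93/200 in Q'; a
   neighbour w of q must avoid that part, which leaves (103 + 2 - 93) / 200 = 6/100. *)
have hside (P' Q' : {set T}) c w : nb e c = P' ->
    mass x P' <= 103 / 200 -> mass x Q' <= 103 / 200 ->
    98 / 100 <= mass x (P' :|: Q') ->
    (exists2 q, q \in P' & e w q) -> mass x (nb e w :&: Q') < 6 / 100.
  move=> hc hP' hQ' hPQ' [q qP wq].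
  have cq : e c q by move: qP; rewrite -hc inE.
  have qc : e q c by rewrite es.
  have h1 := codeg_small cq; rewrite hc setIC in h1.
  have h2 := mass_cover (nb e q) P' Q'.
  have h3 := hnb qc.
  have h4 := codeg_small wq.
  have h5 := mass_overlap (nb e w) (nb e q) Q'.
  lra.
pose col w := [exists q in P, e w q].
have hcolT w : col w -> 83 / 200 <= mass x (nb e w :&: P).
  move=> /exists_inP[q qP wq].
  have h1 := @hside P Q a w erefl.
  have h2 : mass x (nb e w :&: Q) < 6 / 100 by apply: h1; [lra|lra|lra|exists q].
  have := mass_cover (nb e w) P Q; have := hnb wq; lra.
have hcolF w v : e w v -> ~~ col w -> 95 / 200 <= mass x (nb e w :&: Q).
  move=> wv /exists_inPn hw.
  have := mass_cover (nb e w) P Q; have := hnb wv.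
  have -> : nb e w :&: P = set0.
    apply/setP => q; rewrite !inE; apply/negP => /andP[h1 h2].
    by move: (hw q); rewrite !inE h1 h2 => /(_ erefl).
  have -> : mass x set0 = 0 by rewrite /mass big_set0.
  lra.
exists col => u v uv; apply/eqP => huv.
have h1 := codeg_small uv.
have vu : e v u by rewrite es.
case hu : (col u); move: huv; rewrite hu => /esym hv.
  have := hcolT u hu; have := hcolT v hv; have := mass_overlap (nb e u) (nb e v) P; lra.
have := hcolF _ _ uv (negbT hu); have := hcolF _ _ vu (negbT hv).
have := mass_overlap (nb e u) (nb e v) Q; lra.
Qed.

End NoAtoms.

(** * The concentrated case *)

Section Atoms.
Variables (R : realFieldType) (T : finType) (e : rel T) (lam c eps D : R) (x : T -> R).
Hypotheses (es : symmetric e) (ei : irreflexive e) (hx : perron e lam x).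
Hypotheses (eps0 : 0 < eps) (eps1 : eps <= 1) (c0 : 0 <= c) (c1 : c <= eps / 4000).
Hypotheses (D0 : 0 < D) (hD : 4000 <= D * eps ^+ 2).
Hypothesis (hlam : 512 * 2000 * D ^+ 3 <= lam * eps).
Hypothesis hV : forall w, (1 - c) * #|nb e w|%:R <= 2 * lam ^+ 2 * x w ^+ 2.
Hypothesis hE : forall u v, e u v -> 1 <= 8 * lam * (x u * x v).

Let x0 := perron_ge0 hx.

Let Deps : 4000 <= D * eps.
Proof.
apply: le_trans hD _; rewrite ler_pM2l // expr2 ler_piMr //; exact: ltW.
Qed.

Let D1 : 4000 <= D.
Proof. by apply: le_trans Deps _; rewrite ler_piMr // ltW. Qed.

Let lamD : 8 * D ^+ 2 < lam.
Proof.
have h1 : lam * eps <= lam \/ lam < 0.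
  have [l|l] := ltP lam 0; first by right.
  by left; rewrite ler_piMr.
have h2 : 0 < D ^+ 3 by rewrite exprn_gt0.
have h3 : 0 < D ^+ 2 by rewrite exprn_gt0.
have h4 : D ^+ 2 <= D ^+ 3 by rewrite [leRHS]exprS ler_peMl ?(ltW h3) //; have := D1; lra.
have := hlam; case: h1 => h1 h5; first by lra.
have : lam * eps < 0 by rewrite nmulr_rlt0.
lra.
Qed.

Let lam0 : 0 < lam.
Proof. by apply: lt_trans lamD; rewrite mulr_gt0 ?exprn_gt0. Qed.

Lemma edge_pos u v : e u v -> 0 < x u.
Proof.
move=> uv; rewrite lt_def x0 andbT; apply/eqP => h.
by have := hE uv; rewrite h mul0r mulr0; lra.
Qed.

Lemma edge_lower u v : e u v -> 1 <= 8 * lam * x v.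
Proof.
move=> uv; apply: le_trans (hE uv) _; rewrite ler_pM2l ?mulr_gt0 //.
by rewrite ler_piMl // (perron_le1 hx).
Qed.

(** If S supplies all but a fraction k of the eigenvalue sum at [w], Cauchy-Schwarz and the degree
    bound [hV] give it nearly mass 1/2 in the neighbourhood; (1 - k)^2 >= 1 - 2 k. *)
Lemma share w (S : {set T}) k : 0 < x w -> 0 <= k -> k <= 1 ->
  lam * x w * (1 - k) <= \sum_(v in nb e w :&: S) x v ->
  (1 - c) * (1 - 2 * k) <= 2 * mass x (nb e w :&: S).
Proof.
move=> xw k0 k1 hk; set p := mass _ _.
have p0 : 0 <= p by apply: mass_ge0.
have h1 := sum_sqr_le_mass (nb e w :&: S) x; rewrite -/p in h1.
have h2 : #|nb e w :&: S|%:R * p <= #|nb e w|%:R * p.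
  by rewrite ler_wpM2r // ler_nat subset_leq_card // subsetIl.
have h3 : (lam * x w * (1 - k)) ^+ 2 <= #|nb e w|%:R * p.
  apply: le_trans (le_trans h1 h2); rewrite ler_pXn2r // nnegrE.
    by rewrite !mulr_ge0 ?(ltW lam0) ?(ltW xw) //; lra.
  by apply: sumr_ge0.
have c2 : 0 <= 1 - c by have := c1; have := eps1; lra.
have h4 : (1 - c) * (lam * x w * (1 - k)) ^+ 2 <= 2 * lam ^+ 2 * x w ^+ 2 * p.
  apply: le_trans (ler_wpM2l c2 h3) _; rewrite mulrA ler_wpM2r //.
have q0 : 0 < lam ^+ 2 * x w ^+ 2 by rewrite mulr_gt0 ?exprn_gt0.
have h5 : (1 - c) * (1 - k) ^+ 2 <= 2 * p.
  rewrite -(ler_pM2l q0); apply: le_trans (le_trans h4 _).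
    by rewrite le_eqVlt; apply/orP; left; apply/eqP; ring.
  by rewrite le_eqVlt; apply/orP; left; apply/eqP; ring.
apply: le_trans h5; rewrite ler_wpM2l //; have := sqr_ge0 k; lra.
Qed.

(* The edge condition sends the neighbours of a light vertex into [heavy];
   [middle] turns out to be empty. *)
Definition light : {set T} := [set w | (0 < x w) && (lam * x w <= D)].
Definition heavy : {set T} := [set w | 1 <= 8 * D * x w].
Definition middle : {set T} := [set w | (D < lam * x w) && (8 * D * x w < 1)].

Lemma light_heavy_disj w : w \in light -> w \in heavy -> False.
Proof.
rewrite !inE => /andP[_ h1] h2.
have h3 : lam <= lam * (8 * D * x w) by rewrite ler_peMr // ltW.
have h4 : 8 * D * (lam * x w) <= 8 * D * D by rewrite ler_pM2l // mulr_gt0.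
have := lamD; lra.
Qed.

Lemma nb_light b v : b \in light -> e b v -> v \in heavy.
Proof.
rewrite !inE => /andP[_ hb] bv; apply: le_trans (hE bv) _.
have -> : 8 * lam * (x b * x v) = 8 * (lam * x b) * x v by ring.
by rewrite ler_wpM2r // ler_pM2l.
Qed.

Lemma mass_parts : mass x heavy + mass x light + mass x middle <= 1.
Proof.
have h1 := mass_setUI x heavy light; have h2 := mass_setUI x (heavy :|: light) middle.
have e1 : heavy :&: light = set0.
  by apply/setP => w; rewrite !inE -[RHS]/false; apply/negP => /andP[h3 h4];
     apply: (@light_heavy_disj w); rewrite inE.
have e2 : (heavy :|: light) :&: middle = set0.
  apply/setP => w; rewrite !inE; apply/negP => /andP[/orP[h3|/andP[_ h3]] /andP[h4 h5]]; lra.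
have z : mass x set0 = 0 by rewrite /mass big_set0.
rewrite e1 z in h1; rewrite e2 z in h2.
have := perron_mass_le1 hx (heavy :|: light :|: middle); lra.
Qed.

(** A neighbour that is not light has lam x_v > D, so D x_v <= lam x_v^2: such neighbours contribute
    little to the eigenvalue equation. *)
Lemma sum_nonlight_le w (S : {set T}) :
  D * \sum_(v in (nb e w :\: light) :&: S) x v <= lam * mass x ((nb e w :\: light) :&: S).
Proof.
rewrite /mass !mulr_sumr; apply: ler_sum => v; rewrite !inE => /andP[/andP[h wv] _].
have vw : e v w by rewrite es.
move: h; rewrite (edge_pos vw) /= -ltNge => h.
by rewrite expr2 mulrA ler_wpM2r // ltW.
Qed.

Lemma nbsum_split w : lam * x w =
  \sum_(v in nb e w :&: light) x v + \sum_(v in nb e w :\: light) x v.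
Proof. by rewrite -(perron_eq hx) nbsumE (big_setID light). Qed.

Variable u0 : T.
Hypothesis hu0 : eps <= x u0 ^+ 2.

Let xu0 : eps <= x u0.
Proof.
by apply: le_trans hu0 _; rewrite expr2 ler_piMl // (perron_le1 hx).
Qed.

(** Bounds the mass of [middle]: the lower bounds for [heavy] and [light] leave c + eps / 4000, and
    c is at most eps / 4000. *)
Let eta := eps / 2000.

(** Neighbours of [u0] that are not light supply at most lam / D, which is at most the fraction eps
    / 4000 of lam x_u0 because D eps^2 >= 4000. *)
Lemma mass_light_u0 : 1 / 2 - c / 2 - eps / 4000 <= mass x (nb e u0 :&: light).
Proof.
have h := @share u0 light (eps / 4000).
have e1 := eps1; have e0 := eps0; have c1' := c1; have c0' := c0; have xu := xu0.
suff : (1 - c) * (1 - 2 * (eps / 4000)) <= 2 * mass x (nb e u0 :&: light).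
  have : 0 <= c * eps by rewrite mulr_ge0 // ltW.
  lra.
apply: h; [lra|lra|lra|].
have h1 := sum_nonlight_le u0 setT; rewrite setIT in h1.
have h2 := perron_mass_le1 hx (nb e u0 :\: light).
have h3 := nbsum_split u0.
have h4 : D * \sum_(v in nb e u0 :\: light) x v <= lam.
  by apply: le_trans h1 _; rewrite ler_piMr // ltW.
have h5 : lam <= D * (lam * x u0 * (eps / 4000)).
  have -> : D * (lam * x u0 * (eps / 4000)) = lam * (D * (x u0 * eps) / 4000) by field.
  rewrite ler_peMr ?(ltW lam0) //.
  have : D * eps ^+ 2 <= D * (x u0 * eps) by rewrite ler_pM2l // expr2 ler_pM2r.
  by have := hD; lra.
have h6 : \sum_(v in nb e u0 :\: light) x v <= lam * x u0 * (eps / 4000).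
  by rewrite -(ler_pM2l D0); apply: le_trans h4 h5.
lra.
Qed.

Lemma nb_mass u v : e u v -> (1 - c) / 2 <= mass x (nb e u).
Proof.
move=> uv; have := @share u setT 0; rewrite setIT => h.
have : (1 - c) * (1 - 2 * 0) <= 2 * mass x (nb e u).
  apply: h; rewrite ?(edge_pos uv) //.
  by rewrite subr0 mulr1 -(perron_eq hx) nbsumE.
lra.
Qed.

Lemma light_witness : exists2 b, b \in light & e u0 b.
Proof.
have [/existsP[b /andP[h1 h2]]|/existsPn h] := boolP [exists b, (b \in light) && e u0 b].
  by exists b.
exfalso; have := mass_light_u0.
have -> : nb e u0 :&: light = set0.
  apply/setP => b; rewrite [RHS]inE in_setI [b \in nb _ _]inE andbC.
  exact/negbTE/h.
rewrite /mass big_set0; have := eps1; have := c1; lra.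
Qed.

(** The whole neighbourhood of a light vertex is heavy, and every neighbourhood of a non-isolated
    vertex has mass at least (1 - c) / 2. *)
Lemma mass_heavy_ge : (1 - c) / 2 <= mass x heavy.
Proof.
have [b bl ub] := light_witness.
have bu : e b u0 by rewrite es.
apply: le_trans (nb_mass bu) _; apply: mass_sub; apply/subsetP => v.
by rewrite inE => /(nb_light bl).
Qed.

Lemma mass_light_ge : 1 / 2 - c / 2 - eps / 4000 <= mass x light.
Proof. by apply: le_trans mass_light_u0 _; rewrite mass_sub // subsetIr. Qed.

Lemma mass_middle_le : mass x middle <= eta.
Proof.
rewrite /eta; have := mass_parts; have := mass_light_ge; have := mass_heavy_ge; have := c1; lra.
Qed.

(** A crude bound, sufficient because lam exceeds D^3 by a large factor; [card_heavy_eps] improves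
    it to 4 / eps. *)
Lemma card_heavy : #|heavy|%:R <= 64 * D ^+ 2.
Proof.
have h : #|heavy|%:R <= 64 * D ^+ 2 * mass x heavy.
  rewrite /mass mulr_sumr -sumr_const; apply: ler_sum => a; rewrite inE => h.
  have := ler_pM (ltW ltr01) (ltW ltr01) h h.
  by rewrite mulr1; lra.
apply: le_trans h _; rewrite ler_piMr ?(perron_mass_le1 hx) //.
by rewrite mulr_ge0 ?exprn_ge0 ?(ltW D0).
Qed.

(** Of the eigenvalue sum at [a], middle neighbours supply a fraction at most 8 eta and heavy ones
    at most eta, so [share] applies with k = 9 eta. The discount c uses up part of the remaining
    slack. *)
Lemma heavy_light a : a \in heavy -> mass x (light :\: nb e a) <= 11 * eta.
Proof.
move=> ah.
have e1 := eps1; have e0 := eps0; have c1' := c1; have c0' := c0.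
have xa : 1 <= 8 * D * x a by move: ah; rewrite inE.
have xa0 : 0 < x a.
  by rewrite lt_def x0 andbT; apply/eqP => h; move: xa; rewrite h mulr0; lra.
suff hs : (1 - c) * (1 - 2 * (9 * eta)) <= 2 * mass x (nb e a :&: light).
  have := mass_setID x light (nb e a); rewrite setIC.
  have := mass_parts; have := mass_heavy_ge; have := mass_ge0 x middle.
  have : 0 <= c * eps by rewrite mulr_ge0 // ltW.
  move: hs; rewrite /eta; lra.
apply: share => //; [rewrite /eta; lra|rewrite /eta; lra|].
have h1 := nbsum_split a.
rewrite [X in _ = _ + X](big_setID heavy) /= in h1.
have h2 : \sum_(v in (nb e a :\: light) :&: heavy) x v <= 64 * D ^+ 2.
  apply: le_trans (_ : #|heavy|%:R <= _); last exact: card_heavy.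
  apply: le_trans (_ : #|(nb e a :\: light) :&: heavy|%:R <= _).
    by rewrite -sumr_const; apply: ler_sum => v _; apply: perron_le1 hx _.
  by rewrite ler_nat subset_leq_card // subsetIr.
have h3 := sum_nonlight_le a (~: heavy); rewrite -setDE in h3.
have h4 : mass x ((nb e a :\: light) :\: heavy) <= eta.
  apply: le_trans mass_middle_le; apply: mass_sub; apply/subsetP => v.
  rewrite !inE -ltNge => /andP[-> /andP[h av]]; rewrite andbT.
  have va : e v a by rewrite es.
  by move: h; rewrite (edge_pos va) /= -ltNge.
have h5 : \sum_(v in (nb e a :\: light) :\: heavy) x v <= lam * x a * (8 * eta).
  rewrite -(ler_pM2l D0); apply: le_trans h3 _.
  apply: le_trans (ler_wpM2l (ltW lam0) h4) _.
  have -> : D * (lam * x a * (8 * eta)) = lam * (eta * (8 * D * x a)) by ring.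
  rewrite ler_pM2l // ler_peMr // /eta; lra.
have h6 : 64 * D ^+ 2 <= lam * x a * eta.
  have h7 : 512 * D ^+ 3 <= lam * eta by have := hlam; rewrite /eta; lra.
  have h8 : 0 < 8 * D by rewrite mulr_gt0.
  rewrite -(ler_pM2l h8).
  have -> : 8 * D * (lam * x a * eta) = (lam * eta) * (8 * D * x a) by ring.
  have h9 : 0 <= lam * eta by apply: le_trans h7; rewrite mulr_ge0 ?exprn_ge0 ?(ltW D0).
  have := ler_wpM2l h9 xa; lra.
lra.
Qed.

(** Compares the eigenvalue equations at [u0] and [a]. Light vertices missed by [a] have mass at
    most 11 eta, and x_v <= 8 lam x_v^2 there by the edge condition, so the loss is a small multiple
    of lam eps and x_a >= x_u0 / 2. *)
Lemma heavy_lower a : a \in heavy -> eps / 4 <= x a ^+ 2.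
Proof.
move=> ah; have e1 := eps1; have e0 := eps0; have xu := xu0.
suff h : x u0 / 2 <= x a.
  have : (x u0 / 2) ^+ 2 <= x a ^+ 2 by rewrite ler_pXn2r ?nnegrE //; lra.
  have := hu0; lra.
have h1 := nbsum_split u0; have h2 := nbsum_split a.
have h3 : \sum_(v in nb e u0 :&: light) x v <=
   \sum_(v in nb e a :&: light) x v + \sum_(v in light :\: nb e a) x v.
  rewrite (setIC (nb e a)) -(big_setID (nb e a)) /= [leRHS](big_setID (nb e u0)) /=.
  by rewrite (setIC light) lerDl sumr_ge0.
have h4 : \sum_(v in (light :\: nb e a)) x v <= 8 * lam * (11 * eta).
  apply: le_trans (_ : 8 * lam * mass x (light :\: nb e a) <= _); last first.
    by rewrite ler_pM2l ?mulr_gt0 // heavy_light.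
  rewrite /mass mulr_sumr; apply: ler_sum => v; rewrite !inE => /andP[_ /andP[xv _]].
  have [w wv] : exists w, e w v.
    have [/existsP //|/existsPn h] := boolP [exists w, e w v]; exfalso.
    have : lam * x v = 0.
      by rewrite -(perron_eq hx) /nbsum big_pred0 // => w; apply/negbTE; rewrite es.
    by move/eqP; rewrite mulf_eq0 !gt_eqF.
  by rewrite expr2 mulrA ler_peMl // (edge_lower wv).
have h5 := sum_nonlight_le u0 setT; rewrite setIT in h5.
have h6 := perron_mass_le1 hx (nb e u0 :\: light).
have h7 : \sum_(v in nb e u0 :\: light) x v <= lam * (eps / 4000).
  rewrite -(ler_pM2l D0); apply: le_trans h5 _; rewrite mulrCA ler_pM2l //.
  by apply: le_trans h6 _; have := Deps; lra.
have h8 : 0 <= \sum_(v in nb e a :\: light) x v by apply: sumr_ge0.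
rewrite -(ler_pM2l lam0).
have h9 : lam * eps <= lam * x u0 by rewrite ler_pM2l.
move: h4; rewrite /eta => h4.
have h10 : 0 < lam * eps by rewrite mulr_gt0.
lra.
Qed.

Lemma card_heavy_eps : #|heavy|%:R * eps <= 4.
Proof.
have h : #|heavy|%:R * eps <= 4 * mass x heavy.
  rewrite /mass mulr_sumr mulr_natl -sumr_const; apply: ler_sum => a ah.
  have := heavy_lower ah; lra.
have := perron_mass_le1 hx heavy; lra.
Qed.

(** Were [a] missed, the heavy set would contain the neighbourhood of [b], of mass about 1/2, and
    also [a], of mass at least eps / 4; with the light mass this exceeds 1. *)
Lemma light_full b a : b \in light -> a \in heavy -> e b a.
Proof.
move=> bl ah; apply: contraT => nba.
have e1 := eps1; have e0 := eps0; have c1' := c1.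
have h0 : 0 < x b by move: bl; rewrite inE => /andP[].
have [v bv] : exists v, e b v.
  have [/existsP //|/existsPn h] := boolP [exists w, e b w]; exfalso.
  have : lam * x b = 0.
    by rewrite -(perron_eq hx) /nbsum big_pred0 // => w; apply/negbTE.
  by move/eqP; rewrite mulf_eq0 !gt_eqF.
have h1 := nb_mass bv.
have h2 := mass_setID x heavy (nb e b).
have h3 : mass x (nb e b) <= mass x (heavy :&: nb e b).
  apply: mass_sub; apply/subsetP => w hw; rewrite inE hw andbT (nb_light bl) //.
  by move: hw; rewrite inE.
have h4 : x a ^+ 2 <= mass x (heavy :\: nb e b) by apply: mass_mem; rewrite in_setD ah inE nba.
have h5 := heavy_lower ah.
have := mass_parts; have := mass_light_ge; have := mass_ge0 x middle.
lra.
Qed.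

(** A light neighbour would make [w] heavy, and heavy neighbours supply at most half of lam x_w. The
    other half would come from middle vertices, but by the degree bound and their mass at most eta,
    Cauchy-Schwarz makes their sum too small. *)
Lemma middle_empty : middle = set0.
Proof.
apply/setP => w; rewrite [RHS]inE; apply/negP => wm.
have e1 := eps1; have e0 := eps0; have c1' := c1.
have [h1 h2] : D < lam * x w /\ 8 * D * x w < 1 by move: wm; rewrite inE => /andP[].
have nl : nb e w :&: light = set0.
  apply/setP => v; rewrite [RHS]inE; apply/negP; rewrite !inE => /andP[wv hv].
  have vl : v \in light by rewrite inE.
  have := @nb_light v w vl; rewrite es => /(_ wv); rewrite inE; lra.
have h3 := nbsum_split w; rewrite nl big_set0 add0r (big_setID heavy) /= in h3.
have h4 : \sum_(v in (nb e w :\: light) :&: heavy) x v <= #|heavy|%:R.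
  apply: le_trans (_ : #|(nb e w :\: light) :&: heavy|%:R <= _).
    by rewrite -sumr_const; apply: ler_sum => v _; apply: perron_le1 hx _.
  by rewrite ler_nat subset_leq_card // subsetIr.
set S := (nb e w :\: light) :\: heavy in h3.
have h5 := sum_sqr_le_mass S x.
have h6 : mass x S <= eta.
  apply: le_trans mass_middle_le; apply: mass_sub; apply/subsetP => v.
  rewrite !inE -ltNge => /andP[-> /andP[h wv]]; rewrite andbT.
  have vw : e v w by rewrite es.
  by move: h; rewrite (edge_pos vw) /= -ltNge.
have h7 : #|S|%:R * mass x S <= #|nb e w|%:R * eta.
  rewrite ler_pM ?mass_ge0 // ler_nat subset_leq_card //.
  by apply/subsetP => v; rewrite !inE => /andP[_ /andP[]].
have h8 : #|nb e w|%:R * eta <= 4 * (lam * x w) ^+ 2 * eta.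
  rewrite ler_wpM2r //; first by rewrite /eta; lra.
  have := hV w; have : 0 <= #|nb e w|%:R :> R by []; rewrite exprMn.
  have q : 0 <= lam ^+ 2 * x w ^+ 2 by rewrite mulr_ge0 ?sqr_ge0.
  have : c <= 1 / 2 by lra.
  move=> h9 h10 h11; have := ler_wpM2r h10 h9; lra.
have h9 : #|heavy|%:R <= lam * x w / 2.
  have h10 := card_heavy_eps; have h11 : 4000 <= D * eps := Deps.
  have h12 : D * eps < lam * x w * eps by rewrite ltr_pM2r.
  rewrite -(ler_pM2r eps0); lra.
have h10 : lam * x w / 2 <= \sum_(v in S) x v by lra.
have h11 : (lam * x w / 2) ^+ 2 <= (\sum_(v in S) x v) ^+ 2.
  have h12 : 0 <= lam * x w / 2 by have := D0; lra.
  by rewrite ler_pXn2r // nnegrE //; apply: le_trans h10.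
have h12 : 0 < (lam * x w) ^+ 2 by rewrite exprn_gt0 //; apply: lt_trans h1.
move: h7 h8; rewrite /eta => h7 h8.
have h13 : (lam * x w) ^+ 2 * eps <= (lam * x w) ^+ 2 by rewrite ler_piMr // ltW.
lra.
Qed.

Lemma atoms_structure : exists A B : {set T},
  [/\ #|A|%:R * eps <= 4, A :&: B = set0, (0 < #|B|)%N,
      forall a b, a \in A -> b \in B -> e a b
    & forall u v, e u v -> [\/ u \in A /\ v \in A, u \in A /\ v \in B | u \in B /\ v \in A]].
Proof.
exists heavy, light; split.
- exact: card_heavy_eps.
- apply/setP => w; rewrite [RHS]inE; apply/negP; rewrite in_setI => /andP[h1 h2].
  exact: light_heavy_disj h2 h1.
- by have [b bl _] := light_witness; apply/card_gt0P; exists b.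
- by move=> a b ah bl; rewrite es light_full.
have part u v : e u v -> u \in heavy \/ u \in light.
  move=> uv; have : u \notin middle by rewrite middle_empty inE.
  rewrite !inE (edge_pos uv) negb_and -!leNgt => /orP[h|h]; last by left.
  by right.
move=> u v uv; have vu : e v u by rewrite es.
have [uh|ul] := part _ _ uv; have [vh|vl] := part _ _ vu.
- by constructor 1.
- by constructor 2.
- by constructor 3.
- by exfalso; apply: (light_heavy_disj vl); apply: nb_light uv.
Qed.

End Atoms.

(** * Joins and comparison graphs *)

Section Join.
Variables (R : realFieldType) (T : finType).

Section JoinBound.
Variables (e : rel T) (lam : R) (x : T -> R) (A B : {set T}).
Hypotheses (es : symmetric e) (hx : perron e lam x) (l0 : 0 < lam).
Hypotheses (AB : forall a b, a \in A -> b \in B -> e a b).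
Hypothesis (hAB : forall u v, e u v ->
  [\/ u \in A /\ v \in A, u \in A /\ v \in B | u \in B /\ v \in A]).
Hypothesis (dAB : A :&: B = set0).

(* Summing the eigenvalue equations over [A] and over [B] gives
   [lam * SA <= |A| (SA + SB)] and [lam * SB = |B| SA]. *)
Lemma join_bound : lam ^+ 2 <= #|A|%:R * lam + #|A|%:R * #|B|%:R.
Proof.
have x0 := perron_ge0 hx.
pose SA := \sum_(a in A) x a; pose SB := \sum_(b in B) x b.
have SB0 : 0 <= SB by apply: sumr_ge0.
have BnA b : b \in B -> b \in A = false.
  by move=> bB; apply/negP => bA; have /setP/(_ b) := dAB; rewrite !inE bA bB.
have hB b : b \in B -> lam * x b = SA.
  move=> bB; rewrite -(perron_eq hx) /nbsum /SA; apply: eq_bigl => a.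
  apply/idP/idP => [/hAB [[h _]|[h _]|[_ ->] //]|aA]; last by rewrite es AB.
    by rewrite BnA in h.
  by rewrite BnA in h.
have hA a : a \in A -> lam * x a <= SA + SB.
  move=> aA; rewrite -(perron_eq hx) /nbsum (bigID (mem A)) /=; apply: lerD.
    rewrite [SA](bigID (e a)) /= -[leLHS]addr0; apply: lerD; last by apply: sumr_ge0.
    by rewrite le_eqVlt; apply/orP; left; apply/eqP; apply: eq_bigl => v; rewrite andbC.
  rewrite [SB](bigID (e a)) /= -[leLHS]addr0; apply: lerD; last by apply: sumr_ge0.
  rewrite le_eqVlt; apply/orP; left; apply/eqP; apply: eq_bigl => v.
  apply/andP/andP => [[av vA]|[vB av]]; split=> //; last by rewrite BnA.
  by case: (hAB av) => [[_ h]|[_ h]|[_ h]] //; rewrite h in vA.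
have SA0 : 0 < SA.
  rewrite lt_def sumr_ge0 // andbT; apply/eqP => SAz.
  have xA a : a \in A -> x a = 0.
    move=> aA; move/eqP: SAz; rewrite /SA psumr_eq0 // => /allP/(_ a (mem_index_enum _)).
    by rewrite aA => /eqP.
  have xB b : b \in B -> x b = 0.
    by move=> /hB; rewrite SAz => /eqP; rewrite mulf_eq0 gt_eqF //= => /eqP.
  have xz u : x u = 0.
    have : lam * x u = 0.
      rewrite -(perron_eq hx) /nbsum big1 // => v /hAB [[_ h]|[_ h]|[_ h]]; auto.
    by move/eqP; rewrite mulf_eq0 gt_eqF //= => /eqP.
  have := perron_norm hx; rewrite /norm2 big1; last by move=> u _; rewrite xz expr0n.
  by move/esym/eqP; rewrite oner_eq0.
have h1 : lam * SA <= #|A|%:R * (SA + SB).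
  by rewrite /SA mulr_sumr mulr_natl -sumr_const; apply: ler_sum.
have h2 : lam * SB = #|B|%:R * SA.
  by rewrite {1}/SB mulr_sumr mulr_natl -sumr_const; apply: eq_bigr.
rewrite -(ler_pM2r SA0).
have h3 := ler_wpM2l (ltW l0) h1.
have h4 : #|A|%:R * (lam * SB) = #|A|%:R * (#|B|%:R * SA) by rewrite h2.
lra.
Qed.

End JoinBound.

(** * Two rearrangements of edges and their test vectors *)

Section Pendant.
Variables (e : rel T) (lam : R) (x : T -> R) (A : {set T}).
Hypotheses (es : symmetric e) (ei : irreflexive e) (hx : perron e lam x) (l0 : 0 < lam).

Definition inA w := \sum_(v in nb e w :&: A) x v.
Definition outA w := \sum_(v in nb e w :\: A) x v.

Lemma perron_inout w : lam * x w = inA w + outA w.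
Proof. by rewrite -(perron_eq hx) nbsumE (big_setID A). Qed.

Lemma cross_exchange (g h : T -> R) :
  \sum_(a in A) g a * \sum_(w in nb e a :\: A) h w =
  \sum_(w in ~: A) h w * \sum_(a in nb e w :&: A) g a.
Proof.
under eq_bigr do rewrite mulr_sumr.
rewrite (exchange_big_dep (mem (~: A))) /=; last by move=> a w _; rewrite !inE => /andP[].
apply: eq_bigr => w; rewrite inE => wA; rewrite mulr_sumr; apply: eq_big => a.
  by rewrite !inE wA es andbC.
by move=> _; rewrite mulrC.
Qed.

(** The cross term also occurs in [mass_C_eq], so the two identities compare the mass of [A] with
    that of its complement. *)
Lemma mass_A_eq : lam * mass x A =
  \sum_(a in A) x a * inA a + \sum_(w in ~: A) x w * inA w.
Proof.
rewrite -cross_exchange -big_split /mass mulr_sumr; apply: eq_bigr => a _ /=.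
by rewrite -mulrDr -/(outA a) -perron_inout; ring.
Qed.

Lemma mass_C_eq : lam * mass x (~: A) =
  \sum_(w in ~: A) x w * inA w + \sum_(w in ~: A) x w * outA w.
Proof.
rewrite -big_split /mass mulr_sumr; apply: eq_bigr => a _ /=.
by rewrite -mulrDr -perron_inout; ring.
Qed.

(* The edges outside [A] are replaced by [k] pendant edges at [a0]. *)
Definition pendant (k : nat) (a0 : T) : rel (T + 'I_k) := fun p q =>
  match p, q with
  | inl u, inl v => e u v && ((u \in A) || (v \in A))
  | inl u, inr _ => u == a0
  | inr _, inl v => v == a0
  | inr _, inr _ => false
  end.

Lemma arcsum_pendant k a0 (f : T + 'I_k -> T + 'I_k -> R) :
  arcsum (pendant a0) f =
  arcsum (fun u v => e u v && ((u \in A) || (v \in A))) (fun u v => f (inl u) (inl v))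
  + \sum_(i < k) (f (inl a0) (inr i) + f (inr i) (inl a0)).
Proof.
rewrite /arcsum big_sumType /= big_split /= addrA; congr (_ + _).
  under eq_bigr do rewrite big_sumType /=.
  rewrite big_split /=; congr (_ + _).
  rewrite (bigD1 a0) //= eqxx [X in _ + X]big1 ?addr0 // => u /negPf h.
  by rewrite big_pred0.
apply: eq_bigr => i _; rewrite big_sumType /= big_pred1_eq [X in _ + X]big_pred0 ?addr0 //.
Qed.

(** The test vector keeps [x] on [A] and gives every other vertex its neighbour sum in [A] divided
    by lam, as an eigenvector of the new graph for lam would. The left side is the gain from the new
    leaves, the right side the loss from the removed edges. *)
Lemma pendant_bound k a0 : a0 \in A ->
  (forall y : T + 'I_k -> R,
     arcsum (pendant a0) (fun p q => y p * y q) <= lam * norm2 y) ->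
  k%:R * x a0 ^+ 2 <= \sum_(w in ~: A) inA w * outA w.
Proof.
move=> a0A h.
pose z w := if w \in A then x w else inA w / lam.
pose y (p : T + 'I_k) := match p with inl u => z u | inr _ => x a0 / lam end.
have ln : lam != 0 by rewrite gt_eqF.
have zA a : a \in A -> z a = x a by rewrite /z => ->.
have zC w : w \in ~: A -> z w = inA w / lam by rewrite inE /z => /negPf ->.
pose Q := \sum_(w in ~: A) inA w ^+ 2.
have hn : lam * norm2 y = lam * mass x A + (Q + k%:R * x a0 ^+ 2) / lam.
  rewrite /norm2 big_sumType /= sumr_const card_ord (bigID (mem A)) /=.
  have -> : \sum_(i in A) z i ^+ 2 = mass x A by apply: eq_bigr => a aA; rewrite zA.
  have -> : \sum_(i | i \notin A) z i ^+ 2 = Q / lam ^+ 2.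
    rewrite /Q mulr_suml; apply: eq_big => w; first by rewrite inE.
    by move=> wA; rewrite zC ?inE // expr_div_n.
  rewrite -[X in _ + X]mulr_natl; field.
  by rewrite ln.
have hq : arcsum (pendant a0) (fun p q => y p * y q) =
    \sum_(a in A) x a * inA a + 2 * (Q + k%:R * x a0 ^+ 2) / lam.
  rewrite arcsum_pendant /= sumr_const card_ord /arcsum (bigID (mem A)) /=.
  have -> : \sum_(u | u \notin A) \sum_(v | e u v && ((u \in A) || (v \in A))) z u * z v = Q / lam.
    rewrite /Q mulr_suml; apply: eq_big => w; first by rewrite inE.
    move=> wA; rewrite -mulr_sumr zC ?inE //.
    rewrite (_ : \sum_(_ | _) _ = inA w); first by rewrite expr2; ring.
    apply: eq_big => v; first by rewrite !inE (negPf wA).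
    by move=> /andP[_]; rewrite (negPf wA) => /zA.
  have -> : \sum_(u in A) \sum_(v | e u v && ((u \in A) || (v \in A))) z u * z v =
      \sum_(a in A) x a * inA a + Q / lam.
    have -> : Q / lam = \sum_(a in A) x a * \sum_(w in nb e a :\: A) z w.
      rewrite cross_exchange /Q mulr_suml; apply: eq_bigr => w wC; rewrite zC // -/(inA w).
      by rewrite expr2; ring.
    rewrite -big_split; apply: eq_bigr => a aA /=; rewrite -mulrDr -mulr_sumr zA //.
    congr (_ * _); rewrite (bigID (mem A)) /=; congr (_ + _); apply: eq_big => v.
    - by rewrite !inE aA andbT.
    - by move=> /andP[_ /zA].
    - by rewrite !inE aA andbT andbC.
    - by [].
  rewrite -[X in _ + X]mulr_natl zA //; field.
  by rewrite ln.
have := h y; rewrite hn hq mass_A_eq => hle.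
have hz : (Q + k%:R * x a0 ^+ 2) / lam <= \sum_(w in ~: A) x w * inA w by lra.
rewrite ler_pdivrMr // in hz.
have : (\sum_(w in ~: A) x w * inA w) * lam = Q + \sum_(w in ~: A) inA w * outA w.
  rewrite mulr_suml /Q -big_split; apply: eq_bigr => w _ /=.
  by rewrite mulrAC -[x w * lam]mulrC perron_inout; ring.
lra.
Qed.

Definition move_edge (a1 w1 a2 w2 : T) : rel T := fun u v =>
  del_edge e a1 w1 u v || (((u == a2) && (v == w2)) || ((u == w2) && (v == a2))).

Lemma arcsum_move a1 w1 a2 w2 (f : T -> T -> R) : e a1 w1 -> ~~ e a2 w2 -> a2 != w2 ->
  arcsum (move_edge a1 w1 a2 w2) f =
  arcsum e f - (f a1 w1 + f w1 a1) + (f a2 w2 + f w2 a2).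
Proof.
move=> h1 h2 h3; rewrite (arcsum_del_edge f es ei h1) addrK -(arcsum_pair f h3).
apply: arcsum_split => u v; first by rewrite /move_edge => ->.
rewrite /move_edge; case: (boolP (_ || (_ && _))) => h; rewrite ?orbT ?orbF ?andbN //=.
suff -> : del_edge e a1 w1 u v = false by [].
by rewrite /del_edge; case/orP: h => /andP[/eqP-> /eqP->]; rewrite ?(negPf h2) // es (negPf h2).
Qed.

(** The test vector changes [x] at [w1] and [w2] only, by the lost or gained neighbour entry over
    lam. This correction produces the squares on the left, which decide the comparison when the
    entries on [A] are almost equal. *)
Lemma move_bound a1 w1 a2 w2 : e a1 w1 -> ~~ e a2 w2 -> a2 != w2 -> a1 != w2 ->
  w1 != w2 -> ~~ e w1 w2 -> a2 != w1 ->
  (forall y, arcsum (move_edge a1 w1 a2 w2) (fun p q => y p * y q) <= lam * norm2 y) ->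
  2 * lam * (x a2 * x w2) + x a1 ^+ 2 + x a2 ^+ 2 <= 2 * lam * (x a1 * x w1).
Proof.
move=> h1 h2 n1 n2 n3 h3 n4 h.
have n5 : a1 != w1 by apply: contraTneq h1 => ->; rewrite ei.
have ln : lam != 0 by rewrite gt_eqF.
pose d1 := - x a1 / lam; pose d2 := x a2 / lam.
pose dl u := if u == w1 then d1 else if u == w2 then d2 else 0.
pose y u := x u + dl u.
have n3' : (w2 == w1) = false by rewrite eq_sym (negPf n3).
have sumd (g : T -> R) : \sum_u dl u * g u = d1 * g w1 + d2 * g w2.
  rewrite (bigD1 w1) //= [X in _ + X](bigD1 w2) ?n3' //= big1 ?addr0.
    by rewrite /dl eqxx n3' eqxx.
  by move=> u /andP[/negPf u1 /negPf u2]; rewrite /dl u1 u2 mul0r.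
have hn : norm2 y = 1 + 2 * (d1 * x w1 + d2 * x w2) + (d1 ^+ 2 + d2 ^+ 2).
  have -> : norm2 y = norm2 x + 2 * \sum_u dl u * x u + \sum_u dl u * dl u.
    rewrite /norm2 mulr_sumr -!big_split; apply: eq_bigr => u _ /=; rewrite /y; ring.
  by rewrite (perron_norm hx) !sumd /dl eqxx n3' eqxx; ring.
have hq : arcsum e (fun p q => y p * y q) = lam + 2 * lam * (d1 * x w1 + d2 * x w2).
  have -> : arcsum e (fun p q => y p * y q) =
     arcsum e (fun p q => x p * x q) + arcsum e (fun p q => dl p * x q)
     + arcsum e (fun p q => x p * dl q) + arcsum e (fun p q => dl p * dl q).
    rewrite /arcsum -!big_split; apply: eq_bigr => u _ /=; rewrite -!big_split.
    by apply: eq_bigr => v _ /=; rewrite /y; ring.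
  have -> : arcsum e (fun p q => x p * dl q) = arcsum e (fun p q => dl p * x q).
    rewrite /arcsum exchange_nb //; apply: eq_bigr => u _; apply: eq_bigr => v _.
    by rewrite mulrC.
  rewrite (perron_arcsum hx).
  have -> : arcsum e (fun p q => dl p * x q) = lam * (d1 * x w1 + d2 * x w2).
    rewrite /arcsum; under eq_bigr do rewrite -mulr_sumr.
    by rewrite sumd -!/(nbsum e x _) !(perron_eq hx); ring.
  (* [w1] and [w2] are not adjacent. *)
  have -> : arcsum e (fun p q => dl p * dl q) = 0.
    rewrite /arcsum; under eq_bigr do rewrite -mulr_sumr.
    have zz w : w = w1 \/ w = w2 -> \sum_(v | e w v) dl v = 0.
      move=> hw; apply: big1 => v wv; rewrite /dl.
      case: eqP => [vw|_]; first by case: hw wv => -> ; rewrite vw ?ei // es (negPf h3).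
      by case: eqP => [vw|//]; case: hw wv => ->; rewrite vw ?ei // (negPf h3).
    by rewrite sumd !zz ?mulr0 ?addr0 //; [right|left].
  by ring.
have := h y; rewrite arcsum_move // hq hn.
have ya1 : y a1 = x a1 by rewrite /y /dl (negPf n5) (negPf n2) addr0.
have ya2 : y a2 = x a2 by rewrite /y /dl (negPf n4) (negPf n1) addr0.
have yw1 : y w1 = x w1 + d1 by rewrite /y /dl eqxx.
have yw2 : y w2 = x w2 + d2 by rewrite /y /dl n3' eqxx.
rewrite ya1 ya2 yw1 yw2 => hle.
have h5 : 2 * (x a2 * (x w2 + d2)) - 2 * (x a1 * (x w1 + d1)) <= lam * (d1 ^+ 2 + d2 ^+ 2) by lra.
rewrite -(ler_pM2l l0) in h5.
have e1 : lam * d1 = - x a1 by rewrite /d1; field.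
have e2 : lam * d2 = x a2 by rewrite /d2; field.
have e3 : lam * (lam * (d1 ^+ 2 + d2 ^+ 2)) = x a1 ^+ 2 + x a2 ^+ 2.
  have -> : lam * (lam * (d1 ^+ 2 + d2 ^+ 2)) = (lam * d1) ^+ 2 + (lam * d2) ^+ 2 by ring.
  by rewrite e1 e2 sqrrN.
have e4 : lam * (2 * (x a2 * (x w2 + d2)) - 2 * (x a1 * (x w1 + d1))) =
   2 * lam * (x a2 * x w2) + 2 * x a2 * (lam * d2)
   - 2 * lam * (x a1 * x w1) - 2 * x a1 * (lam * d1) by ring.
rewrite e3 e4 e1 e2 in h5.
lra.
Qed.

End Pendant.
End Join.

(** * Graphs close to a join *)

Section Near.
Variables (R : realFieldType) (T : finType) (e : rel T) (lam om : R) (x : T -> R).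
Variables (A B : {set T}).
Hypotheses (es : symmetric e) (ei : irreflexive e) (hx : perron e lam x) (l0 : 0 < lam).
Hypotheses (AB : forall a b, a \in A -> b \in B -> e a b) (dAB : A :&: B = set0).

(** The edges by which the graph exceeds the complete bipartite graph between [A] and [B]; below
    they number at most om^2 lam^2. *)
Definition rest : rel T := fun u v =>
  e u v && ~~ (((u \in A) && (v \in B)) || ((u \in B) && (v \in A))).

Lemma rest_sym : symmetric rest.
Proof. by move=> u v; rewrite /rest es orbC [(u \in B) && _]andbC [(u \in A) && _]andbC. Qed.

Lemma rest_irr : irreflexive rest. Proof. by move=> u; rewrite /rest ei. Qed.

Lemma notAB v : v \in A -> v \in B = false.
Proof. by move=> vA; apply/negP => vB; have /setP/(_ v) := dAB; rewrite !inE vA vB. Qed.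

Lemma degsum_rest : (degsum e)%:R = (degsum rest)%:R + 2 * (#|A|%:R * #|B|%:R) :> R.
Proof.
rewrite !arcsum1.
rewrite (@arcsum_split _ _ e rest
  (fun u v => ((u \in A) && (v \in B)) || ((u \in B) && (v \in A)))).
- congr (_ + _); rewrite /arcsum (bigID (mem A)) /=.
  have -> : \sum_(u in A) \sum_(v | (u \in A) && (v \in B) || (u \in B) && (v \in A)) 1
      = #|A|%:R * #|B|%:R :> R.
    rewrite mulr_natl -sumr_const; apply: eq_bigr => u uA; rewrite -sumr_const.
    by apply: eq_bigl => v; rewrite uA (notAB uA) orbF.
  have -> : \sum_(u | u \notin A) \sum_(v | (u \in A) && (v \in B) || (u \in B) && (v \in A)) 1
      = #|A|%:R * #|B|%:R :> R.
    rewrite mulrC mulr_natl -sumr_const [RHS]big_mkcond [LHS]big_mkcond.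
    apply: eq_bigr => u _; case: (boolP (u \in A)) => uA /=; first by rewrite notAB.
    case: (u \in B); last by rewrite big_pred0.
    by rewrite -sumr_const; apply: eq_bigl => v.
  by ring.
- by move=> u v /andP[].
- move=> u v; rewrite /rest; case: (boolP (_ || _)) => h; rewrite ?andbF ?andbT ?andbN //=.
  by case/orP: h => /andP[h1 h2]; [rewrite AB | rewrite es AB].
Qed.

Hypotheses (om0 : 0 < om) (hs : 16 * #|A|%:R ^+ 2 * om < 1).
Hypotheses (hrest : (degsum rest)%:R <= 2 * (om ^+ 2 * lam ^+ 2)).
Hypothesis (hsl : #|A|%:R <= om ^+ 2 * lam ^+ 2).
Variable a' : T.
Hypothesis a'A : a' \in A.

Let x0 := perron_ge0 hx.

Let s1 : 1 <= #|A|%:R :> R.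
Proof. by rewrite ler1n; apply/card_gt0P; exists a'. Qed.

Let om1 : 16 * #|A|%:R * om < 1.
Proof.
apply: le_lt_trans hs; rewrite ler_pM2r // ler_pM2l // expr2 ler_peMl //.
Qed.

Let om2 : 16 * om < 1.
Proof. by apply: le_lt_trans om1; rewrite ler_pM2r //; have := s1; lra. Qed.

Lemma card_nb_rest w (S : {set T}) : (forall v, v \in S -> e w v -> rest w v) ->
  #|nb e w :&: S|%:R <= om ^+ 2 * lam ^+ 2.
Proof.
move=> hS; have := degsum_del_vertex R w rest_sym rest_irr.
have : #|nb e w :&: S|%:R <= #|nb rest w|%:R :> R.
  rewrite ler_nat; apply/subset_leq_card/subsetP => v; rewrite !inE => /andP[wv vS].
  exact: hS.
have : 0 <= (degsum (del_vertex rest w))%:R :> R by [].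
have := hrest; lra.
Qed.

(** Both eigenvalue equations contain the full sum over [B]. The other neighbours of [a] number at
    most om^2 lam^2, so by Cauchy-Schwarz they add at most om lam. *)
Lemma A_close a b : a \in A -> b \in A -> x a - x b <= om.
Proof.
move=> aA bA.
have split c : c \in A -> lam * x c = \sum_(v in B) x v + \sum_(v in nb e c :\: B) x v.
  move=> cA; rewrite -(perron_eq hx) nbsumE (big_setID B) /=; congr (_ + _).
  by apply: eq_bigl => v; rewrite !inE; case: (boolP (v \in B)) => vB; rewrite ?andbF ?AB.
have h1 := split _ aA; have h2 := split _ bA.
have h3 : 0 <= \sum_(v in nb e b :\: B) x v by apply: sumr_ge0.
have h4 := sum_sqr_le_mass (nb e a :\: B) x.
have h5 : #|nb e a :\: B|%:R <= om ^+ 2 * lam ^+ 2.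
  rewrite setDE; apply: card_nb_rest => v; rewrite inE /rest => vB ->.
  by rewrite (negPf vB) (notAB aA) andbF.
have h6 : (\sum_(v in nb e a :\: B) x v) ^+ 2 <= (om * lam) ^+ 2.
  apply: le_trans h4 _; rewrite exprMn; apply: le_trans h5.
  by rewrite ler_piMr // (perron_mass_le1 hx).
have h7 : \sum_(v in nb e a :\: B) x v <= om * lam.
  move: h6; rewrite ler_pXn2r // ?nnegrE ?sumr_ge0 // mulr_ge0 //; exact: ltW.
rewrite -(ler_pM2l l0); lra.
Qed.

Lemma card_nb_out w : w \notin A -> #|nb e w :\: A|%:R <= om ^+ 2 * lam ^+ 2.
Proof.
move=> wA; rewrite setDE; apply: card_nb_rest => v; rewrite inE /rest => vA ->.
by rewrite (negPf vA) (negPf wA) andbF.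
Qed.

(** Subtracting [mass_A_eq] from [mass_C_eq] cancels the cross term. Edges outside [A] belong to
    [rest] and contribute at most 2 om lam, so the complement outweighs [A] by at most 2 om. *)
Lemma mass_A_lower : 1 / 4 <= mass x A.
Proof.
have h1 := mass_A_eq A es hx; have h2 := mass_C_eq A hx.
have h3 : 0 <= \sum_(a in A) x a * inA e x A a.
  by apply: sumr_ge0 => a _; rewrite mulr_ge0 // sumr_ge0.
set q := \sum_(w in ~: A) x w * outA e x A w in h2.
have q0 : 0 <= q by apply: sumr_ge0 => w _; rewrite mulr_ge0 // sumr_ge0.
have h4 : q ^+ 2 <= (2 * om * lam) ^+ 2.
  apply: le_trans (cauchy_schwarz _ _ _) _.
  have h5 : \sum_(w in ~: A) outA e x A w ^+ 2 <= (degsum rest)%:R.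
    rewrite /degsum natr_sum big_mkcond; apply: ler_sum => w _.
    case: ifP => // wA; apply: le_trans (sum_sqr_le_mass _ _) _.
    apply: le_trans (_ : #|nb e w :\: A|%:R <= _).
      by rewrite ler_piMr // (perron_mass_le1 hx).
    rewrite ler_nat; apply/subset_leq_card/subsetP => v; rewrite !inE => /andP[vA wv].
    rewrite /rest wv; rewrite inE in wA; by rewrite (negPf vA) (negPf wA) andbF.
  have h6 : mass x (~: A) <= 1 by apply: perron_mass_le1 hx _.
  have h7 : 0 <= \sum_(w in ~: A) outA e x A w ^+ 2 by apply: sumr_ge0 => w _; apply: sqr_ge0.
  have h8 := ler_wpM2r h7 h6.
  have h9 : 0 <= om ^+ 2 * lam ^+ 2 by rewrite mulr_ge0 ?sqr_ge0.
  apply: le_trans h8 _; rewrite mul1r; apply: le_trans h5 _; have := hrest; lra.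
have h5 : q <= 2 * om * lam.
  by move: h4; rewrite ler_pXn2r // nnegrE !mulr_ge0 // ltW.
have h6 : mass x A + mass x (~: A) = 1.
  rewrite -(perron_norm hx) -mass_setT (mass_setID x setT A) setTI.
  by rewrite setTD.
have h7 : lam * (mass x (~: A) - mass x A) <= lam * (2 * om) by lra.
rewrite ler_pM2l // in h7; have := om2; lra.
Qed.

Lemma out_small w : w \notin A -> x w <= 2 * om.
Proof.
move=> wA.
have h1 := perron_deg hx w.
have h2 : #|nb e w|%:R <= 2 * (om ^+ 2 * lam ^+ 2).
  have := card_nb_out wA; have := hsl.
  have : #|nb e w :&: A|%:R <= #|A|%:R :> R by rewrite ler_nat subset_leq_card // subsetIr.
  have : #|nb e w|%:R = #|nb e w :&: A|%:R + #|nb e w :\: A|%:R :> R by rewrite -natrD cardsID.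
  lra.
have h3 : #|nb e w|%:R * mass x (nb e w) <= #|nb e w|%:R.
  by rewrite ler_piMr // (perron_mass_le1 hx).
have h4 : lam ^+ 2 * x w ^+ 2 <= lam ^+ 2 * (2 * om ^+ 2) by lra.
rewrite ler_pM2l ?exprn_gt0 // in h4.
have h5 : x w ^+ 2 <= (2 * om) ^+ 2 by have := sqr_ge0 om; lra.
by move: h5; rewrite ler_pXn2r // nnegrE // mulr_ge0 // ltW.
Qed.

Lemma A_top : exists a0, [/\ a0 \in A, forall a, a \in A -> x a <= x a0
   & 1 <= 4 * #|A|%:R * x a0].
Proof.
have [a0 a0A h] := Order.TotalTheory.arg_maxP x a'A.
exists a0; split => //.
have h1 : mass x A <= #|A|%:R * x a0 ^+ 2.
  rewrite mulr_natl -sumr_const; apply: ler_sum => a aA.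
  by rewrite ler_pXn2r ?nnegrE //; apply: h.
have h2 : #|A|%:R * x a0 ^+ 2 <= #|A|%:R * x a0.
  by rewrite ler_wpM2l // expr2 ler_piMl // (perron_le1 hx).
have := mass_A_lower; lra.
Qed.

Lemma inA_le a0 w : (forall a, a \in A -> x a <= x a0) -> inA e x A w <= #|A|%:R * x a0.
Proof.
move=> h; apply: le_trans (_ : \sum_(v in A) x a0 <= _); last first.
  by rewrite sumr_const mulr_natl.
rewrite /inA [leRHS](big_setID (nb e w)) /= setIC -[leLHS]addr0; apply: lerD.
  by apply: ler_sum => v; rewrite inE => /andP[/h].
by apply: sumr_ge0.
Qed.

Lemma top_large a0 : 1 <= 4 * #|A|%:R * x a0 -> 4 * #|A|%:R * om < x a0.
Proof.
move=> h; have s0 : 0 < 4 * #|A|%:R :> R by have := s1; lra.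
rewrite -(ltr_pM2l s0); apply: lt_le_trans h.
by have := hs; lra.
Qed.

Definition inC : rel T := fun u v => [&& e u v, u \notin A & v \notin A].

(** Take a0 with the largest entry on [A]. Entries outside [A] are at most 2 om, so the loss in
    [pendant_bound] is at most 4 om k |A| x_a0, below the gain k x_a0^2 by [top_large] unless k =
    0. *)
Lemma no_edge_outside (k : nat) : (degsum inC = 2 * k)%N ->
  (forall a0, a0 \in A -> forall y : T + 'I_k -> R,
     arcsum (pendant e A (k := k) a0) (fun p q => y p * y q) <= lam * norm2 y) ->
  k = 0%N.
Proof.
move=> hk hp; have [a0 [a0A hmax h1]] := A_top.
have h2 := top_large h1.
have h3 := pendant_bound es hx l0 a0A (hp a0 a0A).
have h4 : \sum_(w in ~: A) inA e x A w * outA e x A w <=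
    #|A|%:R * x a0 * \sum_(w in ~: A) outA e x A w.
  rewrite mulr_sumr; apply: ler_sum => w _; rewrite ler_wpM2r ?sumr_ge0 //.
  exact: inA_le.
have h5 : \sum_(w in ~: A) outA e x A w <= 2 * om * (2 * k%:R).
  rewrite -natrM -hk /degsum natr_sum mulr_sumr big_mkcond; apply: ler_sum => w _.
  rewrite inE; case: (boolP (w \in A)) => wA /=.
    by rewrite !mulr_ge0 // ltW.
  apply: le_trans (_ : \sum_(v in nb e w :\: A) 2 * om <= _).
    by apply: ler_sum => v; rewrite !inE => /andP[vA _]; apply: out_small.
  rewrite sumr_const -[leLHS]mulr_natr ler_wpM2l ?mulr_ge0 ?(ltW om0) // ler_nat.
  apply/subset_leq_card/subsetP => v; rewrite !inE => /andP[vA wv].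
  by rewrite /inC wv wA vA.
have s0 : 0 <= #|A|%:R * x a0 by rewrite mulr_ge0.
have h6 := ler_wpM2l s0 h5.
apply/eqP; rewrite -(pnatr_eq0 R) eq_le ler0n andbT leNgt; apply/negP => k0.
have xa : 0 < x a0.
  by apply: le_lt_trans h2; rewrite !mulr_ge0 // ltW.
have h7 : k%:R * x a0 * (4 * #|A|%:R * om) < k%:R * x a0 * x a0 by rewrite ltr_pM2l // mulr_gt0.
clear hk; lra.
Qed.

Hypothesis (Cind : forall u v, u \notin A -> v \notin A -> e u v = false).
Hypothesis (noiso : forall u, exists v, e u v).

(** Moving an edge at [w1] to the missing pair [a2 w2] costs little, as entries on [A] differ by at
    most om and x_w1 <= x_w2; the squares in [move_bound] outweigh the cost. So a vertex not joined
    to all of [A] has a strictly smaller entry than every other vertex outside [A]. *)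
Lemma one_nonfull_aux w1 w2 a2 :
  (forall a1 w1 a2 w2, a1 \in A -> a2 \in A -> w1 \notin A -> w2 \notin A ->
    e a1 w1 -> ~~ e a2 w2 ->
    forall y, arcsum (move_edge e a1 w1 a2 w2) (fun p q => y p * y q) <= lam * norm2 y) ->
  w1 \notin A -> w2 \notin A -> w1 != w2 -> x w1 <= x w2 -> a2 \in A -> ~~ e a2 w2 -> False.
Proof.
move=> hm w1A w2A w12 hw a2A ha2.
have nA a w : a \in A -> w \notin A -> a != w by move=> aA; apply: contraNneq => <-.
have [a1 w1a1] := noiso w1.
have a1A : a1 \in A.
  by apply: contraTT w1a1 => h; rewrite Cind.
have ha1 : e a1 w1 by rewrite es.
have := @move_bound _ _ e lam x es ei hx l0 a1 w1 a2 w2 ha1 ha2.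
move=> /(_ (nA _ _ a2A w2A) (nA _ _ a1A w2A) w12 (negbT (Cind w1A w2A)) (nA _ _ a2A w1A)).
move=> /(_ (hm _ _ _ _ a1A a2A w1A w2A ha1 ha2)) h.
have [a0 [a0A hmax h1]] := A_top.
have h2 := top_large h1.
have h3 : lam * x w1 <= #|A|%:R * x a0.
  rewrite (perron_inout A hx) [outA _ _ _ _]big1 ?addr0; first exact: inA_le.
  by move=> v; rewrite !inE => /andP[vA]; rewrite Cind.
have h4 : lam * (x a2 * x w1) <= lam * (x a2 * x w2) by rewrite ler_pM2l // ler_wpM2l.
have h5 : lam * x w1 * (x a1 - x a2) <= #|A|%:R * x a0 * om.
  apply: le_trans (_ : lam * x w1 * om <= _); last by rewrite ler_wpM2r // ltW.
  by rewrite ler_wpM2l ?mulr_ge0 ?(ltW l0) // A_close.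
have b1 := A_close a0A a1A; have b2 := A_close a0A a2A.
have h6 : 4 * om <= 4 * #|A|%:R * om by rewrite ler_pM2r //; have := s1; lra.
have h7 : 3 * x a0 / 4 <= x a1 by lra.
have h8 : 3 * x a0 / 4 <= x a2 by lra.
have xa : 0 < x a0 by have := om0; lra.
have h9 (z : R) : 3 * x a0 / 4 <= z -> 9 / 16 * x a0 ^+ 2 <= z ^+ 2.
  move=> hz; have -> : 9 / 16 * x a0 ^+ 2 = (3 * x a0 / 4) ^+ 2 by field.
  rewrite ler_pXn2r ?nnegrE //; lra.
have h10 := h9 _ h7; have h11 := h9 _ h8.
have h12 : x a0 * (4 * #|A|%:R * om) < x a0 * x a0 by rewrite ltr_pM2l.
have h13 : 0 < x a0 ^+ 2 by rewrite exprn_gt0.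
lra.
Qed.

End Near.

(** * Embeddings of the forbidden graph *)

(** A variant of [contains] for hosts on any finite type, since comparison graphs live on types such
    as T + 'I_k. *)
Definition embeds (F : graph) (T : finType) (e : rel T) : Prop :=
  exists phi : 'I_(gn F) -> T,
    injective phi /\ forall x y, gadj F x y -> e (phi x) (phi y).

Lemma degsum_nedges (G : graph) : degsum (gadj G) = (2 * nedges G)%N.
Proof.
have -> : degsum (gadj G) = \sum_(p : 'I_(gn G) * 'I_(gn G) | gadj G p.1 p.2) 1%N.
  rewrite -(pair_big_dep xpredT (fun u v => gadj G u v) (fun _ _ => 1%N)) /=.
  by apply: eq_bigr => u _; rewrite sum1_card; apply: eq_card => v; rewrite !inE.
rewrite (bigID (fun p : 'I_(gn G) * 'I_(gn G) => p.1 < p.2)%N) /=.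
rewrite mul2n -addnn /nedges -sum1_card; congr (_ + _)%N.
  by apply: eq_bigl => p; rewrite !inE andbC.
rewrite (reindex_inj (h := fun p : 'I_(gn G) * 'I_(gn G) => (p.2, p.1))) /=; last first.
  by move=> [a b] [c d] /= [-> ->].
apply: eq_bigl => p; rewrite inE (@gsym G) -leqNgt leq_eqVlt andbC.
case: eqP => //= h; have -> : p.1 = p.2 by apply: val_inj.
by rewrite (@girr G) !andbF.
Qed.

Section GraphOf.
Variables (T : finType) (e : rel T).
Hypotheses (es : symmetric e) (ei : irreflexive e).

Definition graph_of : graph :=
  @Graph #|T| (fun i j => e (enum_val i) (enum_val j))
    (fun i j => es _ _) (fun i => ei _).

Lemma embeds_graph_of F : contains graph_of F -> embeds F e.
Proof.
case=> phi [phi_inj phi_hom]; exists (fun x => enum_val (phi x)); split => //.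
by move=> x y /enum_val_inj/phi_inj.
Qed.

Lemma degsum_graph_of : degsum (gadj graph_of) = degsum e.
Proof.
rewrite /degsum [RHS](reindex (@enum_val T T)) /=; last first.
  by apply: onW_bij; apply: enum_val_bij.
apply: eq_bigr => i _; rewrite -(card_imset _ (@enum_val_inj T T)); apply: eq_card => v.
apply/imsetP/idP => [[j]|]; first by rewrite !inE => h ->.
by rewrite inE => h; exists (enum_rank v); rewrite ?inE /= ?enum_rankK.
Qed.

Lemma op_bound_graph_of (R : realFieldType) (lam : R) :
  op_bound (gadj graph_of) lam -> op_bound e lam.
Proof.
move=> h y; have := h (fun i => y (enum_val i)).
have re (g : T -> R) : \sum_(i < #|T|) g (enum_val i) = \sum_u g u.
  by rewrite [RHS](reindex (@enum_val T T)) //; apply: onW_bij; apply: enum_val_bij.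
have re2 (P : pred T) (g : T -> R) :
    \sum_(i < #|T| | P (enum_val i)) g (enum_val i) = \sum_(u | P u) g u.
  by rewrite [RHS](reindex (@enum_val T T)) //; apply: onW_bij; apply: enum_val_bij.
rewrite /norm2 (re (fun u => y u ^+ 2)) -(re (fun u => nbsum e y u ^+ 2)).
by under eq_bigr do rewrite /nbsum /= (re2 (fun v => e (enum_val _) v)).
Qed.

End GraphOf.

Section Extremal.
Variables (F G : graph) (m : nat) (lam : algR).
Hypotheses (hext : spectral_extremal F m G) (hr : spectral_radius G (val lam)).

(** Extremality transported to any finite type; [z] only witnesses that the type is inhabited, as
    [perron_exists] requires. *)
Lemma extremal_op_bound (T : finType) (e : rel T) (z : T) :
  symmetric e -> irreflexive e -> ~ embeds F e -> degsum e = (2 * m)%N ->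
  exists lam' : algR, [/\ 0 <= lam', lam' <= lam & op_bound e lam'].
Proof.
move=> es ei hF hd.
have [|lam' [x [hr' l0 _ hop]]] := @perron_exists (graph_of es ei).
  by apply/card_gt0P; exists z.
exists lam'; split => //; last exact: op_bound_graph_of hop.
case: hext => _ [_ /(_ (graph_of es ei))] h.
apply: h hr hr'; first by move/embeds_graph_of.
apply/eqP; rewrite -(eqn_pmul2l (m := 2)) // -degsum_nedges degsum_graph_of.
by rewrite hd.
Qed.

Lemma extremal_rayleigh (T : finType) (e : rel T) (z : T) (y : T -> algR) :
  symmetric e -> irreflexive e -> ~ embeds F e -> degsum e = (2 * m)%N ->
  arcsum e (fun p q => y p * y q) <= lam * norm2 y.
Proof.
move=> es ei hF hd; have [lam' [l0 le hop]] := extremal_op_bound z es ei hF hd.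
apply: le_trans (rayleigh_arcsum y l0 hop) _.
by rewrite ler_wpM2r // norm2_ge0.
Qed.

End Extremal.

Lemma extremal_sqr_ge (F G : graph) m (lam : algR) :
  no_isolated F -> ~ is_star F -> spectral_extremal F m G ->
  spectral_radius G (val lam) -> 0 <= lam -> m%:R <= lam ^+ 2.
Proof.
move=> noF nstar hext hr l0.
(* The star with m edges and centre [ord0]; testing it with the indicator of the centre gives m
   below. *)
pose e : rel 'I_m.+1 := fun u v => (u == ord0) != (v == ord0).
have es : symmetric e by move=> u v; rewrite /e eq_sym.
have ei : irreflexive e by move=> u; rewrite /e eqxx.
have nb0 : nb e ord0 = [set~ ord0] by apply/setP => v; rewrite !inE /e eqxx; case: (v == _).
have [||lam' [l'0 lle hop]] := extremal_op_bound hext hr ord0 es ei.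
- case=> phi [phi_inj phi_hom].
  case: (pickP (fun c => phi c == ord0)) => [c /eqP hc|hn].
    apply: nstar; exists c => x y /phi_hom; rewrite /e.
    case: (phi x =P ord0) => [hx _|_]; first by left; apply: phi_inj; rewrite hx hc.
    by case: (phi y =P ord0) => // hy _; right; apply: phi_inj; rewrite hy hc.
  case: hext => hfree _; apply: hfree.
  have F0 (x : 'I_(gn F)) : False.
    by have [y /phi_hom] := noF x; rewrite /e !hn.
  by exists (fun x => False_rect _ (F0 x)); split => x; case: (F0 x).
- rewrite /degsum big_ord_recl nb0 cardsC1 card_ord /=.
  rewrite (eq_bigr (fun=> 1%N)) ?sum1_card ?card_ord; first by rewrite mul2n addnn.
  move=> i _; rewrite (_ : nb e _ = [set ord0]) ?cards1 //.
  by apply/setP => v; rewrite !inE /e /=; case: (v == _).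
have h1 : m%:R <= lam' ^+ 2.
  have := hop (fun u => (u == ord0)%:R); rewrite /norm2.
  rewrite [X in _ <= _ * X](bigD1 ord0) //= ?eqxx expr1n.
  rewrite [X in _ * (_ + X)]big1 ?addr0 ?mulr1; last first.
    by move=> u hu; rewrite (negPf hu) expr0n.
  apply: le_trans; rewrite big_ord_recl /= -[leLHS]add0r; apply: lerD; first exact: sqr_ge0.
  rewrite -[m in leLHS]card_ord -sumr_const; apply: ler_sum => i _.
  by rewrite /nbsum (big_pred1 ord0) /= ?eqxx ?expr1n // => v; rewrite /e /=; case: (v == _).
by apply: le_trans h1 _; rewrite ler_pXn2r ?nnegrE.
Qed.

Lemma exists_inj_into (T : finType) (U : {set T}) t : (t <= #|U|)%N ->
  exists g : 'I_t -> T, injective g /\ forall i, g i \in U.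
Proof.
move=> h; exists (fun i => enum_val (widen_ord h i)); split => [i j /enum_val_inj []|i].
  by move=> hij; apply: val_inj.
exact: enum_valP.
Qed.

(** The colour class of the exceptional edge goes into [U], the other into [W]. Transpositions
    inside [U] bring the exceptional edge onto [a b]. *)
Lemma almost_bipartite_Kplus (F : graph) (T : finType) (e : rel T) :
  almost_bipartite F -> symmetric e -> irreflexive e -> ~ embeds F e ->
  Kplus_free e (gn F).
Proof.
move=> [col [a' [b' hcol]]] es ei hF U W a b hU hW aU bU ab UW; apply: hF.
have [g [g_inj gU]] := exists_inj_into hU.
have [k [k_inj kW]] := exists_inj_into hW.
have disj u : u \in U -> u \in W -> False by move=> h1 h2; have := UW u u h1 h2; rewrite ei.
have anb : a != b by apply: contraTneq ab => ->; rewrite ei.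
have [h [h_inj hU' ha hb]] : exists h : 'I_(gn F) -> T,
    [/\ injective h, forall i, h i \in U, h a' = a & a' != b' -> h b' = b].
  have tpU (u v w : T) : u \in U -> v \in U -> w \in U -> tperm u v w \in U.
    by case: tpermP => // ->.
  pose h1 i := tperm (g a') a (g i).
  have h1a : h1 a' = a by rewrite /h1 tpermL.
  have h1U i : h1 i \in U by apply: tpU.
  have h1_inj : injective h1 by move=> i j /perm_inj/g_inj.
  (* If a' = b', no edge of [F] joins vertices of the same colour, and only the image of a' is
     prescribed. *)
  have [ab'|ab'] := eqVneq a' b'; first by exists h1; split.
  exists (fun i => tperm (h1 b') b (h1 i)); split.
  - by move=> i j /perm_inj/h1_inj.
  - by move=> i; apply: tpU.
  - rewrite h1a tpermD ?[b == a]eq_sym //.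
    by rewrite -h1a; apply: contra ab' => /eqP/h1_inj ->.
  - by rewrite tpermL.
exists (fun x => if col x == col a' then h x else k x); split.
  move=> x y; case: ifP => hx; case: ifP => hy.
  - exact: h_inj.
  - by move=> E; exfalso; apply: (disj (h x)) => //; rewrite E.
  - by move=> E; exfalso; apply: (disj (h y)) => //; rewrite -E.
  - exact: k_inj.
move=> x y xy; have nxy : x != y by apply: contraTneq xy => ->; rewrite (@girr F).
case: (boolP (col x == col y)) => [/eqP hxy|hxy].
  case: (hcol _ _ xy hxy) => [[ex ey]|[ex ey]]; subst x y.
    by rewrite eqxx -hxy eqxx ha hb.
  by rewrite hxy eqxx ha hb 1?eq_sym // es.
case: ifP => hx; case: ifP => hy.
- by move: hxy; rewrite (eqP hx) (eqP hy) eqxx.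
- exact: UW.
- by rewrite es; apply: UW.
- by move: hxy hx hy; case: (col x); case: (col y); case: (col a').
Qed.

(** A copy of F[V \ I] in [A] extends to a copy of [F] by sending I into [B]: no edge is required
    inside I, and all edges between [A] and [B] are present. *)
Lemma join_in_M (F G : graph) (A B : {set 'I_(gn G)}) :
  F_free F G -> (gn F <= #|B|)%N ->
  (forall a b, a \in A -> b \in B -> gadj G a b) -> in_M F A.
Proof.
move=> hF hB hAB I hI [phi [phi_inj [phiA phi_hom]]]; apply: hF.
have [k [k_inj kB]] := exists_inj_into hB.
have disj u : u \in A -> u \in B -> False.
  by move=> h1 h2; have := hAB u u h1 h2; rewrite (@girr G).
have phiA' x : x \notin I -> phi x \in A by move=> xI; apply: phiA; rewrite inE.
exists (fun x => if x \in I then k x else phi x); split.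
  move=> x y; case: ifP => hx; case: ifP => hy.
  - exact: k_inj.
  - by move=> E; exfalso; apply: (disj (phi y)); [apply: phiA'; rewrite hy|rewrite -E].
  - by move=> E; exfalso; apply: (disj (phi x)); [apply: phiA'; rewrite hx|rewrite E].
  - by apply: phi_inj; rewrite inE ?hx ?hy.
move=> x y xy; case: ifP => hx; case: ifP => hy.
- move: hI => /maxsetP[/forall_inP/(_ x hx)/forall_inP/(_ y hy)].
  by rewrite xy.
- by rewrite (@gsym G); apply: hAB => //; apply: phiA'; rewrite hy.
- by apply: hAB => //; apply: phiA'; rewrite hx.
- by apply: phi_hom => //; rewrite inE ?hx ?hy.
Qed.

(** The vertices of [F] sent outside A' form an independent set. Enlarge it to a maximal one: its
    complement still lands in A', and [f] carries it to a member of A_F inside [A]. *)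
Lemma in_M_free (F G : graph) (A : {set 'I_(gn G)}) (T : finType) (e : rel T)
    (A' : {set T}) (f : T -> 'I_(gn G)) :
  in_M F A -> {in A' &, injective f} -> {in A', forall u, f u \in A} ->
  {in A' &, forall u v, e u v -> gadj G (f u) (f v)} ->
  (forall u v, e u v -> (u \in A') || (v \in A')) -> ~ embeds F e.
Proof.
move=> hM f_inj fA f_hom he [phi [phi_inj phi_hom]].
pose I0 := [set x | phi x \notin A'].
have I0ind : independent I0.
  apply/forall_inP => x; rewrite inE => hx; apply/forall_inP => y; rewrite inE => hy.
  by apply/negP => /phi_hom/he; rewrite (negPf hx) (negPf hy).
have [I hI sI] := maxset_exists I0ind.
have hA' x : x \in ~: I -> phi x \in A'.
  rewrite inE; apply: contraNT => h; apply: (subsetP sI); by rewrite inE.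
apply: (hM I hI); exists (fun x => f (phi x)); split; last split.
- by move=> x y hx hy /(f_inj _ _ (hA' _ hx) (hA' _ hy))/phi_inj.
- by move=> x /hA'/fA.
- by move=> x y hx hy /phi_hom/(f_hom _ _ (hA' _ hx) (hA' _ hy)).
Qed.

(** * Optimal subgraphs and the join case *)

Lemma degsum_sub_eq (T : finType) (e e' : rel T) :
  (forall u v, e' u v -> e u v) -> (degsum e <= degsum e')%N -> e =2 e'.
Proof.
move=> sub hle u v; apply/idP/idP => [uv|]; last exact: sub.
apply: contraT => nuv; pose e'' u v := e u v && ~~ e' u v.
have h := @arcsum_split rat T e e' e'' (fun _ _ => 1) sub (fun _ _ => erefl).
have h1 : 1 <= arcsum e'' (fun _ _ => 1) :> rat.
  by apply: (@arcsum_mem rat T e'' (fun _ _ => 1) u v) => //; rewrite /e'' uv nuv.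
rewrite -!arcsum1 in h h1.
by move: hle; rewrite -(ler_nat rat); lra.
Qed.

Section OptimalSubgraph.
Variables (G : graph) (lam c : algR) (x : 'I_(gn G) -> algR).
Hypotheses (n0 : (0 < gn G)%N) (hx : perron (gadj G) lam x).

Lemma optimal_subgraph : exists (e : rel 'I_(gn G)) (mu : algR) (z : 'I_(gn G) -> algR),
  [/\ symmetric e, irreflexive e, (forall u v, e u v -> gadj G u v),
      0 <= mu /\ perron e mu z &
      lam ^+ 2 - (1 - c) / 2 * (degsum (gadj G))%:R <= mu ^+ 2 - (1 - c) / 2 * (degsum e)%:R
      /\ forall e', symmetric e' -> (forall u v, e' u v -> e u v) ->
         exists mu' : algR, [/\ 0 <= mu', op_bound e' mu' &
           mu' ^+ 2 - (1 - c) / 2 * (degsum e')%:R <= mu ^+ 2 - (1 - c) / 2 * (degsum e)%:R]].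
Proof.
pose T := 'I_(gn G).
(* Requiring both orders makes [sub E] symmetric for every E, so the maximum can run over a finite
   type; by [subE] every symmetric subgraph occurs. *)
pose sub (E : {set T * T}) : rel T := fun u v => [&& gadj G u v, (u, v) \in E & (v, u) \in E].
have sub_s E : symmetric (sub E).
  by move=> u v; rewrite /sub (@gsym G) [((u, v) \in E) && _]andbC.
have sub_i E : irreflexive (sub E) by move=> u; rewrite /sub (@girr G).
have /fin_all_exists [f hf] : forall E, exists mu : algR,
    exists z : T -> algR, [/\ 0 <= mu, perron (sub E) mu z & op_bound (sub E) mu].
  move=> E; have [//|mu [z [_ m0 hz hmu]]] := @perron_exists (@Graph _ (sub E) (sub_s E) (sub_i E)).
  by exists mu, z; split.
pose Phi E := f E ^+ 2 - (1 - c) / 2 * (degsum (sub E))%:R.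
have [E _ hmax] := @Order.TotalTheory.arg_maxP _ algR _ set0 xpredT Phi erefl.
have [z [m0 hz hmu]] := hf E.
exists (sub E), (f E), z; split => //; first by move=> u v /and3P[].
have subE (e' : rel T) : symmetric e' -> (forall u v, e' u v -> gadj G u v) ->
    sub [set p | e' p.1 p.2] =2 e'.
  move=> es' h u v; rewrite /sub !inE /= (es' v) andbb; apply/andP/idP => [[]//|uv].
  by split=> //; apply: h.
have degE e1 e2 : e1 =2 e2 -> degsum (T := T) e1 = degsum e2.
  move=> h; apply: eq_bigr => u _; apply: eq_card => v; by rewrite !inE h.
split.
  apply: le_trans (hmax [set p | gadj G p.1 p.2] erefl).
  have hE := subE _ (@gsym G) (fun u v h => h).
  rewrite /Phi (degE _ _ hE) lerD2r.
  have [y [l0 hy hopE]] := hf [set p | gadj G p.1 p.2].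
  (* The radius chosen by [f] for the full edge set is not [lam] by definition; testing its norm
     bound on [x] shows that its square is at least lam^2. *)
  have := hopE x; rewrite (perron_norm hx) mulr1; apply: le_trans.
  rewrite /norm2 (eq_bigr (fun u => lam ^+ 2 * x u ^+ 2)).
    by rewrite -mulr_sumr -/(norm2 x) (perron_norm hx) mulr1.
  move=> u _; rewrite -exprMn -(perron_eq hx); congr (_ ^+ 2).
  by apply: eq_bigl => v; rewrite hE.
move=> e' es' he'.
have hE : sub [set p | e' p.1 p.2] =2 e' by apply: subE => // u v /he' /and3P[].
have [y [l0 hy hopE]] := hf [set p | e' p.1 p.2].
exists (f [set p | e' p.1 p.2]); split => //; last first.
  by have := hmax [set p | e' p.1 p.2] erefl; rewrite /Phi (degE _ _ hE).
move=> w; apply: le_trans (hopE w); rewrite le_eqVlt; apply/orP; left; apply/eqP.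
by apply: eq_bigr => u _; congr (_ ^+ 2); apply: eq_bigl => v; rewrite hE.
Qed.

End OptimalSubgraph.

Lemma pendant_free (F G : graph) (A : {set 'I_(gn G)}) k a0 :
  in_M F A -> a0 \in A -> ~ embeds F (pendant (gadj G) A (k := k) a0).
Proof.
move=> hM a0A; apply: (@in_M_free F G A _ _ [set p | if p is inl u then u \in A else false]
   (fun p => if p is inl u then u else a0) hM).
- by move=> [u|i] [v|j]; rewrite !inE // => _ _ ->.
- by move=> [u|i]; rewrite inE.
- by move=> [u|i] [v|j]; rewrite !inE // => _ _ /andP[].
- move=> [u|i] [v|j]; rewrite !inE //=; first by case/andP.
    by move=> /eqP ->; rewrite a0A.
  by move=> /eqP ->.
Qed.

Section JoinCase.
Variables (F G : graph) (m : nat) (lam om : algR) (x : 'I_(gn G) -> algR).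
Variables (A B : {set 'I_(gn G)}).
Hypotheses (hF : almost_bipartite F) (hG : no_isolated G).
Hypotheses (hext : spectral_extremal F m G) (hr : spectral_radius G (val lam)).
Hypotheses (l0 : 0 < lam) (hx : perron (gadj G) lam x) (hm : m%:R <= lam ^+ 2).
Hypotheses (AB : forall a b, a \in A -> b \in B -> gadj G a b) (dAB : A :&: B = set0).
Hypotheses (om0 : 0 < om) (hs : 16 * #|A|%:R ^+ 2 * om < 1).
Hypotheses (hrest : (degsum (rest (gadj G) A B))%:R <= 2 * (om ^+ 2 * lam ^+ 2)).
Hypothesis (hsl : #|A|%:R <= om ^+ 2 * lam ^+ 2).
Hypotheses (A0 : (0 < #|A|)%N) (hB : (gn F <= #|B|)%N).

Let es := @gsym G.
Let ei := @girr G.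
Let hfree : F_free F G. Proof. by case: hext. Qed.
Let hdeg : degsum (gadj G) = (2 * m)%N.
Proof. by rewrite degsum_nedges; case: hext => _ [->]. Qed.

Lemma join_case : complete_bipartite G \/ outcome_b F G.
Proof.
have [a' a'A] := card_gt0P A0.
have hM := join_in_M hfree hB AB.
have Cs : symmetric (inC (gadj G) A).
  by move=> u v; rewrite /inC es [(u \notin A) && _]andbC.
have Ci : irreflexive (inC (gadj G) A) by move=> u; rewrite /inC ei.
(* The number of edges outside [A]; as many pendant edges keep the total at m. *)
pose k := nedges (Graph Cs Ci).
have hk : degsum (inC (gadj G) A) = (2 * k)%N by apply: (degsum_nedges (Graph Cs Ci)).
have k0 : k = 0%N.
  apply: (no_edge_outside es ei hx l0 om0 hs hrest hsl a'A hk) => a0 a0A y.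
  apply: (extremal_rayleigh hext hr (inl a0)).
  - by move=> [u|i] [v|j] //=; rewrite es orbC.
  - by move=> [u|i] //=; rewrite ei.
  - exact: pendant_free.
  - apply/eqP; rewrite -(eqr_nat algR) -hdeg arcsum1 arcsum_pendant sumr_const card_ord.
    rewrite -arcsum1 [in X in _ == X]arcsum1.
    rewrite (@arcsum_split _ _ _ (fun u v => gadj G u v && ((u \in A) || (v \in A)))
       (inC (gadj G) A)) => [|u v /andP[]//|u v].
      rewrite -!arcsum1 hk natrM; apply/eqP; rewrite -[X in _ + X = _]mulr_natr.
      by ring.
    by rewrite /inC; case: (gadj G u v); rewrite //= negb_or.
have Cind u v : u \notin A -> v \notin A -> gadj G u v = false.
  move=> uA vA; apply/negP => uv; have : inC (gadj G) A u v by rewrite /inC uv uA vA.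
  move=> h; move: hk; rewrite k0 muln0 => /eqP; rewrite sum_nat_eq0 => /forallP/(_ u).
  by rewrite /= cards_eq0 => /eqP/setP/(_ v); rewrite !inE h.
have hmove a1 w1 a2 w2 : a1 \in A -> a2 \in A -> w1 \notin A -> w2 \notin A ->
    gadj G a1 w1 -> ~~ gadj G a2 w2 ->
    forall y, arcsum (move_edge (gadj G) a1 w1 a2 w2) (fun p q => y p * y q) <= lam * norm2 y.
  move=> a1A a2A w1A w2A h1 h2 y.
  have n2 : a2 != w2 by apply: contraNneq w2A => <-.
  apply: (extremal_rayleigh hext hr a1).
  - move=> u v; rewrite /move_edge /del_edge es.
    by rewrite [(u == a1) && _]andbC [(u == w1) && _]andbC [(u == a2) && _]andbC
       [(u == w2) && _]andbC [X in _ && ~~ X]orbC [X in _ || X]orbC.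
  - move=> u; rewrite /move_edge /del_edge ei /=; apply/negP.
    by case/orP => /andP[/eqP h3 /eqP h4]; move: n2; rewrite -h3 -h4 eqxx.
  - apply: (@in_M_free F G A _ _ A id hM) => // [u v uA vA|u v].
      case/orP => [/andP[]//|/orP[]/andP[/eqP h3 /eqP h4]].
        by move: w2A; rewrite -h4 vA.
      by move: w2A; rewrite -h3 uA.
    case/orP => [/andP[uv _]|/orP[]/andP[/eqP -> /eqP ->]]; rewrite ?a2A ?orbT //.
    by apply: contraT; rewrite negb_or => /andP[h3 h4]; rewrite Cind in uv.
  - apply/eqP; rewrite -(eqr_nat algR) -hdeg !arcsum1 arcsum_move //.
    by apply/eqP; ring.
have aux := @one_nonfull_aux _ _ _ lam om x A B es ei hx l0 AB dAB om0 hs hrest a' a'A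
   Cind hG.
have [/existsP[p /existsP[q /and3P[pA qA pq]]]|/existsPn hno] :=
  boolP [exists p, exists q, [&& p \in A, q \in A & gadj G p q]].
  right; exists A; split; last split.
  (* Otherwise [A], [B] and the edge [p q] contain K_{t,t} with an extra edge, t = |F|. *)
  - rewrite ltnNge; apply/negP => hA.
    have hK := almost_bipartite_Kplus hF es ei hfree.
    exact: (hK A B p q hA hB pA qA pq AB).
  - by exists p, q.
  - split=> //; split.
      apply/forall_inP => u; rewrite inE => uA; apply/forall_inP => v; rewrite inE => vA.
      by rewrite Cind.
    (* By [aux], two incompletely joined vertices would each have a strictly smaller entry than the
       other, so the first one found is the only exception. *)
    have [/existsP[c0 /andP[c0A /exists_inP[a2 a2A hc0]]]|/existsPn hfull] :=
      boolP [exists w, (w \notin A) && [exists a in A, ~~ gadj G a w]].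
      exists c0 => c; rewrite inE => cA cc0 a aA; rewrite es; apply: contraT => hca.
      exfalso; case: (leP (x c) (x c0)) => hle.
        exact: (aux c c0 a2 hmove).
      by apply: (aux c0 c a hmove) => //; [rewrite eq_sym|apply: ltW].
    exists a' => c cA _ a aA; rewrite es; apply: contraT => hca.
    move: (hfull c); rewrite inE in cA; rewrite cA /= => /exists_inPn/(_ a aA).
    by rewrite hca.
left; exists (mem A).
have hcol u v : gadj G u v -> (u \in A) != (v \in A).
  move=> uv; case: (boolP (u \in A)) => uA; case: (boolP (v \in A)) => vA //.
    by move: (hno u) => /existsPn/(_ v); rewrite uA vA uv.
  by rewrite Cind in uv.
apply: (bipartite_complete l0 hx hcol) => //.
by rewrite hdeg natrM; have := hm; lra.
Qed.

End JoinCase.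

(** * Choice of constants and conclusion *)

Lemma degsum_sub (T : finType) (e e' : rel T) :
  (forall u v, e' u v -> e u v) -> (degsum e' <= degsum e)%N.
Proof.
move=> h; apply: leq_sum => u _; apply/subset_leq_card/subsetP => v.
by rewrite !inE; apply: h.
Qed.

(* [eps] is the mass from which a vertex counts as heavy, [c] the discount in
   the potential, [D / lam] the bound on light entries, [L] a lower bound for the
   spectral radius. In [size_consts], [K] bounds the size of the heavy set and [om]
   measures how close [G] is to the join. *)
Record atom_consts (R : realFieldType) (t : nat) (eps c D L : R) : Prop := AtomConsts {
  eps_gt0 : 0 < eps;
  eps_le1 : eps <= 1;
  eps_t : t%:R * eps <= 1 / 12;
  eps_kst : 6 ^+ t * (t%:R * eps) < 1 / 100;
  c_gt0 : 0 < c;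
  c_le : c <= eps / 4000;
  D_gt0 : 0 < D;
  D_ge : 4000 <= D * eps ^+ 2;
  L_gt0 : 0 < L;
  L_ge : 512 * 2000 * D ^+ 3 <= L * eps }.

Record size_consts (R : realFieldType) (t : nat) (eps c L K om M : R) : Prop := SizeConsts {
  K_gt0 : 0 < K;
  K_ge : 4 <= K * eps;
  om_gt0 : 0 < om;
  om_le : 16 * K ^+ 2 * om < 1;
  om_le_half : om <= 1 / 2;
  M_ge1 : 1 <= M;
  M_L : L ^+ 2 <= c * M;
  M_om : 2 * K ^+ 2 <= (c * om ^+ 2) ^+ 2 * M;
  M_t : 2 * K * t%:R <= M;
  M_K : K <= om ^+ 2 * M }.

Lemma consts_exist (R : archiRealFieldType) (t : nat) : exists eps c D L K om : R,
  atom_consts t eps c D L /\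
  exists m0 : nat, forall m, (m0 <= m)%N -> size_consts t eps c L K om m%:R.
Proof.
(* [t.+1] keeps E at least 1 even for t = 0; the factor 200 gives 6^t t eps <= 1/200. *)
pose E : R := 200 * 6 ^+ t * t.+1%:R; pose eps := E^-1; pose c := eps / 4000.
pose D := 4000 / eps ^+ 2; pose L := 512 * 2000 * D ^+ 3 / eps.
pose K := 4 / eps; pose om := (17 * K ^+ 2)^-1.
(* Each lower bound required of m is a nonnegative summand, so m >= X meets all of them. *)
pose X := 1 + L ^+ 2 / c + 2 * K ^+ 2 / (c * om ^+ 2) ^+ 2 + 2 * K * t%:R + K / om ^+ 2.
have t6 : 1 <= 6 ^+ t :> R by rewrite exprn_ege1 // ler1n.
have t1 : 1 <= t.+1%:R :> R by rewrite ler1n.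
have E1 : 1 <= E.
  have h := ler_pM ler01 ler01 t6 t1; rewrite mulr1 in h.
  by rewrite /E -mulrA; clear -h; lra.
have E0 : 0 < E by apply: lt_le_trans E1.
have e0 : 0 < eps by rewrite invr_gt0.
have e1 : eps <= 1 by rewrite invf_le1.
have eE : eps * E = 1 by rewrite mulVf // gt_eqF.
have c0 : 0 < c by rewrite divr_gt0.
have D0 : 0 < D by rewrite divr_gt0 ?exprn_gt0.
have L0 : 0 < L by rewrite divr_gt0 // mulr_gt0 ?exprn_gt0 // mulr_gt0.
have K0 : 0 < K by rewrite divr_gt0.
have K4 : K * eps = 4 by rewrite divfK // gt_eqF.
have om0 : 0 < om by rewrite invr_gt0 mulr_gt0 ?exprn_gt0.
have omK : om * (17 * K ^+ 2) = 1 by rewrite mulVf // gt_eqF // mulr_gt0 ?exprn_gt0.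
have K1 : 1 <= K ^+ 2.
  rewrite exprn_ege1 //; have := ler_wpM2l (ltW K0) e1; rewrite K4 mulr1.
  by apply: le_trans; rewrite ler1n.
exists eps, c, D, L, K, om; split.
  split=> //.
  - have h : 200 * t%:R <= E.
      rewrite /E -mulrA; have h := ler_pM ler01 ler01 t6 t1.
      have h2 : t%:R <= 6 ^+ t * t.+1%:R :> R.
        by rewrite -[leLHS]mul1r ler_pM ?ler01 ?ler0n // ler_nat.
      by clear -h2; lra.
    have := ler_wpM2l (ltW e0) h; rewrite eE; clear; lra.
  - have h : 200 * (6 ^+ t * t%:R) <= E.
      by rewrite /E -mulrA ler_pM2l // ler_wpM2l ?ler_nat // exprn_ge0.
    have := ler_wpM2l (ltW e0) h; rewrite eE; clear; lra.
  - by rewrite /D divfK // gt_eqF // exprn_gt0.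
  - by rewrite /L divfK // gt_eqF.
exists (Num.bound X) => m hm.
have p1 : 0 < c * om ^+ 2 by rewrite mulr_gt0 ?exprn_gt0.
have p2 : 0 < (c * om ^+ 2) ^+ 2 by rewrite exprn_gt0.
have q1 : 0 <= L ^+ 2 / c by rewrite divr_ge0 ?exprn_ge0 // ltW.
have q2 : 0 <= 2 * K ^+ 2 / (c * om ^+ 2) ^+ 2.
  by rewrite divr_ge0 ?(ltW p2) // mulr_ge0 ?exprn_ge0 // ltW.
have q3 : 0 <= 2 * K * t%:R by rewrite mulr_ge0 // mulr_ge0 // (ltW K0).
have q4 : 0 <= K / om ^+ 2 by rewrite divr_ge0 ?exprn_ge0 // ltW.
have hX : X <= m%:R.
  apply: le_trans (_ : (Num.bound X)%:R <= _); last by rewrite ler_nat.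
  by apply/ltW/archi_boundP; rewrite /X !addr_ge0.
have gen (a b d f y : R) : 0 <= a -> 0 <= b -> 0 <= d -> 0 <= f ->
    1 + a + b + d + f <= y -> [/\ 1 <= y, a <= y, b <= y, d <= y & f <= y].
  by clear => h1 h2 h3 h4 h5; split; lra.
have [r0 r1 r2 r3 r4] := gen _ _ _ _ _ q1 q2 q3 q4 hX.
split=> //.
- by rewrite K4.
- by move: omK; clear; lra.
- have h := ler_wpM2l (ltW om0) K1; move: omK h; clear; lra.
- by move: r1; rewrite ler_pdivrMr // [leRHS]mulrC.
- by move: r2; rewrite ler_pdivrMr // [leRHS]mulrC.
- by move: r4; rewrite ler_pdivrMr ?exprn_gt0 // mulrC.
Qed.

(** * The two cases for an optimal subgraph *)

Section Dichotomy.
Variables (R : realFieldType) (T : finType) (g e : rel T) (t : nat).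
Variables (eps c D L K om M lam mu : R) (z : T -> R).
Hypotheses (ha : atom_consts t eps c D L) (hb : size_consts t eps c L K om M).
Hypotheses (gs : symmetric g) (es : symmetric e) (ei : irreflexive e).
Hypothesis sub : forall u v, e u v -> g u v.
Hypotheses (dG : (degsum g)%:R = 2 * M) (hm : M <= lam ^+ 2).
Hypotheses (mu0 : 0 <= mu) (hz : perron e mu z).
Hypothesis hPhi :
  lam ^+ 2 - (1 - c) / 2 * (degsum g)%:R <= mu ^+ 2 - (1 - c) / 2 * (degsum e)%:R.
Hypothesis hopt : forall e', symmetric e' -> (forall u v, e' u v -> e u v) ->
   exists mu', [/\ 0 <= mu', op_bound e' mu' &
     mu' ^+ 2 - (1 - c) / 2 * (degsum e')%:R <= mu ^+ 2 - (1 - c) / 2 * (degsum e)%:R].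
Hypothesis hfree : Kplus_free e t.

Let c1 : c <= 1 / 100.
Proof. have := c_le ha; have := eps_le1 ha; lra. Qed.

(** The graph [g] itself has potential at least M - (1 - c) M, and the optimum does no worse. *)
Let hcm : c * M <= mu ^+ 2 - (1 - c) / 2 * (degsum e)%:R.
Proof. have := hPhi; have := hm; rewrite dG; lra. Qed.

Let muL : L <= mu.
Proof.
have h : 0 <= (1 - c) / 2 * (degsum e)%:R by rewrite mulr_ge0 //; have := c1; lra.
have h2 : L ^+ 2 <= mu ^+ 2 by have := M_L hb; have := hcm; lra.
by move: h2; rewrite ler_pXn2r ?nnegrE // ltW // (L_gt0 ha).
Qed.

Let mup : 0 < mu. Proof. exact: lt_le_trans (L_gt0 ha) muL. Qed.

Let hV := optimal_vertex es ei mup hz (ltW (c_gt0 ha)) hopt.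

Let c2 : c <= 1 / 2. Proof. have := c1; lra. Qed.

Let hE := @optimal_edge _ _ _ _ _ _ es ei hz c2 hopt.

Lemma dichotomy_spread : (forall v, z v ^+ 2 <= eps) ->
  exists col : T -> bool, forall u v, g u v -> col u != col v.
Proof.
move=> heps.
have nbm u v : e u v -> 99 / 200 <= mass z (nb e u).
  move=> uv; have h1 := perron_deg hz u; have h2 := hV u.
  have d0 : 0 < #|nb e u|%:R :> R.
    by rewrite ltr0n; apply/card_gt0P; exists v; rewrite inE.
  have h3 : #|nb e u|%:R * ((1 - c) / 2) <= #|nb e u|%:R * mass z (nb e u) by lra.
  rewrite ler_pM2l // in h3; have := c1; lra.
have [col hcol] := no_atoms_bipartite es hz hfree heps (eps_t ha) (eps_kst ha) nbm.
have h1 := bipartite_sqr_le mup hz hcol.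
(* As mu^2 <= e(H), the potential is at most c e(H); being at least c M, it forces e(H) >= M. *)
have h2 : (degsum g <= degsum e)%N.
  rewrite -(ler_nat R) dG.
  have h3 : c * (2 * M) <= c * (degsum e)%:R by have := hcm; lra.
  by rewrite ler_pM2l ?(c_gt0 ha) // in h3.
have he := degsum_sub_eq sub h2.
by exists col => u v; rewrite he; apply: hcol.
Qed.

Lemma dichotomy_atom u0 : eps <= z u0 ^+ 2 ->
  exists A B : {set T},
    [/\ forall a b, a \in A -> b \in B -> g a b, A :&: B = set0,
        16 * #|A|%:R ^+ 2 * om < 1,
        (degsum (rest g A B))%:R <= 2 * (om ^+ 2 * lam ^+ 2)
      & [/\ #|A|%:R <= om ^+ 2 * lam ^+ 2, (0 < #|A|)%N & (t <= #|B|)%N]].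
Proof.
move=> hu0; have eps0 := eps_gt0 ha.
have hlam : 512 * 2000 * D ^+ 3 <= mu * eps.
  by apply: le_trans (L_ge ha) _; rewrite ler_pM2r.
have [A [B [hA dAB B0 AB hAB]]] :=
  atoms_structure es hz eps0 (eps_le1 ha) (ltW (c_gt0 ha)) (c_le ha) (D_gt0 ha) (D_ge ha)
    hlam hV hE hu0.
have AB' a b : a \in A -> b \in B -> g a b by move=> aA bB; apply/sub/AB.
clear hu0 hlam; exists A, B.
have om0 := om_gt0 hb; have K0 := K_gt0 hb; have c0 := c_gt0 ha; have M1 := M_ge1 hb.
have sK : #|A|%:R <= K by rewrite -(ler_pM2r eps0); apply: le_trans hA (K_ge hb).
(* [join_bound] bounds mu^2 from above and e(H) is at least |A| |B|, so the potential leaves at most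
   |A| mu / c of the M edges outside the join. *)
have hjoin : c * M <= #|A|%:R * mu + c * (#|A|%:R * #|B|%:R).
  have h1 := join_bound es hz mup AB hAB dAB.
  have h2 := degsum_rest R es AB dAB.
  have h3 : 0 <= (degsum (rest e A B))%:R :> R by [].
  have h4 : (1 - c) / 2 * (2 * (#|A|%:R * #|B|%:R)) <= (1 - c) / 2 * (degsum e)%:R.
    by rewrite ler_wpM2l //; have := c1; lra.
  have := hcm; lra.
have mu2 : mu ^+ 2 <= 2 * M.
  by apply: le_trans (perron_sqr_le hz) _; rewrite -dG ler_nat; apply: degsum_sub.
have hsize : M - #|A|%:R * #|B|%:R <= om ^+ 2 * M.
  (* mu is at most the square root of 2 M, so K mu is of lower order than M; [M_om] is this
     comparison squared. *)
  have h1 : K * mu <= c * om ^+ 2 * M.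
    have h2 : (K * mu) ^+ 2 <= (c * om ^+ 2 * M) ^+ 2.
      have h3 := ler_wpM2l (sqr_ge0 K) mu2.
      have M0 : 0 <= M by lra.
      have h4 := ler_wpM2r M0 (M_om hb).
      rewrite [leLHS]exprMn [leRHS]exprMn; lra.
    move: h2; rewrite ler_pXn2r // nnegrE; first by rewrite mulr_ge0 // ltW.
    by rewrite !mulr_ge0 ?sqr_ge0 // ?(ltW c0) //; lra.
  have h5 : #|A|%:R * mu <= K * mu by rewrite ler_wpM2r.
  rewrite -(ler_pM2l c0); lra.
have om2 : om ^+ 2 <= 1 / 4.
  have := ler_pM (ltW om0) (ltW om0) (om_le_half hb) (om_le_half hb); rewrite -expr2; lra.
have M0 : 0 <= M by lra.
have hsk : M / 2 <= #|A|%:R * #|B|%:R by have := ler_wpM2r M0 om2; lra.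
have homlam := ler_wpM2l (sqr_ge0 om) hm.
split=> //; last split.
- apply: le_lt_trans (om_le hb); rewrite ler_pM2r // ler_pM2l // ler_pXn2r ?nnegrE //.
  exact: ltW.
- by have h1 := degsum_rest R gs AB' dAB; rewrite dG in h1; lra.
- by apply: le_trans sK _; apply: le_trans (M_K hb) _.
- rewrite lt0n; apply/eqP => Az; move: hsk; rewrite Az mul0r; clear Az; lra.
- rewrite -(ler_nat R) -(ler_pM2l K0).
  have h2 : #|A|%:R * #|B|%:R <= K * #|B|%:R by rewrite ler_wpM2r.
  have := M_t hb; lra.
Qed.

End Dichotomy.

Theorem theorem1p8 (F : graph) :
  no_isolated F -> almost_bipartite F -> ~ is_star F ->
  exists m0 : nat, forall m : nat, (m0 <= m)%N ->
    forall G : graph, no_isolated G -> spectral_extremal F m G ->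
      complete_bipartite G \/ outcome_b F G.
Proof.
move=> noF abF nstar.
have [eps [c [D [L [K [om [ha [m0 hm0]]]]]]]] := consts_exist algR (gn F).
exists m0 => m /hm0 hb G noG hext; clear hm0.
have dG : degsum (gadj G) = (2 * m)%N by rewrite degsum_nedges; case: hext => _ [->].
have dG' : (degsum (gadj G))%:R = 2 * m%:R :> algR by rewrite dG natrM.
have G0 : (0 < gn G)%N.
  rewrite lt0n; apply/eqP => g0; move: dG; rewrite /degsum big1.
    by have := M_ge1 hb; rewrite ler1n; case: (m).
  by move=> u; have := ltn_ord u; rewrite [X in (_ < X)%N]g0.
have [lam [x [hr l0 hx hop]]] := perron_exists G0.
have hm := extremal_sqr_ge noF nstar hext hr l0.
have lp : 0 < lam.
  rewrite lt_def l0 andbT; apply/eqP => lz; move: hm; rewrite lz expr0n /= leNgt.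
  by rewrite (lt_le_trans ltr01 (M_ge1 hb)).
have [e [mu [z [es ei sub [mu0 hz] [hPhi hopt]]]]] := optimal_subgraph c G0 hx.
have hfree : ~ embeds F e.
  case: hext => hfree _ [phi [phi_inj phi_hom]]; apply: hfree; exists phi; split => //.
  by move=> u v /phi_hom/sub.
have hK := almost_bipartite_Kplus abF es ei hfree.
have [/existsP[u0 hu0]|/existsPn hna] := boolP [exists u, eps <= z u ^+ 2].
  have [A [B [AB dAB h1 h2 [h3 h4 h5]]]] :=
    dichotomy_atom ha hb (@gsym G) es ei sub dG' hm mu0 hz hPhi hopt hu0.
  exact: (join_case abF noG hext hr lp hx hm AB dAB (om_gt0 hb) h1 h2 h3 h4 h5).
have heps v : z v ^+ 2 <= eps by have := hna v; rewrite -ltNge => /ltW.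
have [col hcol] := dichotomy_spread ha hb es ei sub dG' hm mu0 hz hPhi hopt hK heps.
left; exists col; apply: (bipartite_complete lp hx hcol _ noG).
by rewrite dG' ler_wpM2l.
Qed.
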